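(* Let $\mathbf{X}:\Omega\to\mathbb{R}^M$ be a random vector with finite differential entropy, zero mean and covariance $\operatorname{diag}(\lambda_1,\dots,\lambda_M)$ with $\lambda_i>0$. Let $\mathbf{U}\sim\mathcal{N}(0,\mathbf{I})$ be independent of $\mathbf{X}$, fix $\theta>0$, set $\gamma_i^2=\min(1,\theta/\lambda_i)$ and define $$Z_i=\sqrt{1-\gamma_i^2}\,X_i+\gamma_i\sqrt{\lambda_i}\,U_i,\quad i=1,\dots,M,$$ and let $\hat{\mathbf{X}}$ be drawn from the conditional distribution $P(\mathbf{X}\mid\mathbf{Z})$ (i.e. $\hat{\mathbf{X}}$ is conditionally independent of $\mathbf{X}$ given $\mathbf{Z}$ and $(\hat{\mathbf{X}},\mathbf{Z})$ has the same joint distribution as $(\mathbf{X},\mathbf{Z})$). Let $\mathbf{X}^*$ be a Gaussian random vector with the same mean and covariance as $\mathbf{X}$, and let $\mathbf{Z}^*$ be defined as $\mathbf{Z}$ but with $\mathbf{X}^*$ in place of $\mathbf{X}$ (with noise independent of $\mathbf{X}^*$). Let $R$ and $R^*$ be the rate-distortion functions of $\mathbf{X}$ and $\mathbf{X}^*$, respectively, and let $D=\mathbb{E}[\|\mathbf{X}-\hat{\mathbf{X}}\|^2]$. Then $$I[\mathbf{X},\mathbf{Z}]\le R^*(D/2)-D_{\mathrm{KL}}(P_{\mathbf{Z}}\,\|\,P_{\mathbf{Z}^*})\le R(D/2)+D_{\mathrm{KL}}(P_{\mathbf{X}}\,\|\,P_{\mathbf{X}^*})-D_{\mathrm{KL}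}(P_{\mathbf{Z}}\,\|\,P_{\mathbf{Z}^*}).$$
   Context: All logarithms (in mutual information, KL divergence and rates) are to base 2. For a random vector $\mathbf{X}$ in $\mathbb{R}^M$, its (information) rate-distortion function under squared error is $R(D)=\inf I[\mathbf{X},\hat{\mathbf{X}}]$, the infimum over all conditional distributions of $\hat{\mathbf{X}}$ given $\mathbf{X}$ such that $\mathbb{E}[\|\mathbf{X}-\hat{\mathbf{X}}\|^2]\le D$. $P_{\mathbf{Y}}$ denotes the distribution of a random vector $\mathbf{Y}$. *)

(* Defs.v *)
From HB Require Import structures.
From mathcomp Require Import all_boot all_order all_algebra.
From mathcomp Require Import all_classical all_reals all_analysis.
Set Implicit Arguments. Unset Strict Implicit. Unset Printing Implicit Defensive.
Import Order.TTheory GRing.Theory Num.Theory.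
Import numFieldNormedType.Exports.
Local Open Scope classical_set_scope.
Local Open Scope ring_scope.

Section pairing.
Context {d d1 d2 : measure_display} {T : measurableType d}
  {T1 : measurableType d1} {T2 : measurableType d2}.

Definition pairf (f : {mfun T >-> T1}) (g : {mfun T >-> T2}) : T -> T1 * T2 :=
  fun w => (f w, g w).

Lemma pairf_measurable (f : {mfun T >-> T1}) (g : {mfun T >-> T2}) :
  measurable_fun [set: T] (pairf f g).
Proof. by apply: measurable_fun_pair. Qed.

HB.instance Definition _ f g :=
  isMeasurableFun.Build _ _ _ _ (pairf f g) (pairf_measurable f g).

Definition fstf : T1 * T2 -> T1 := fst.
Definition sndf : T1 * T2 -> T2 := snd.
HB.instance Definition _ := isMeasurableFun.Build _ _ _ _ fstf measurable_fst.
HB.instance Definition _ := isMeasurableFun.Build _ _ _ _ sndf measurable_snd.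
End pairing.

Definition log2 {R : realType} (x : R) : R := ln x / ln 2.

Section information.
Context {R : realType}.
Local Open Scope ereal_scope.

Definition KL {d} {T : measurableType d} (P Q : probability T R) : \bar R :=
  if pselect (P `<< Q) then
    \int[P]_x (log2 (fine (Radon_Nikodym (charge_of_finite_measure P) Q x)))%:E
  else +oo.

Definition mutual_info {d d1 d2} {T : measurableType d}
  {T1 : measurableType d1} {T2 : measurableType d2} (P : probability T R)
  (X : {mfun T >-> T1}) (Y : {mfun T >-> T2}) : \bar R :=
  KL (distribution P (pairf X Y)) (distribution P X \x distribution P Y).
End information.

(* Vectors of R^M are represented as M.-tuple R, with the product      *)
(* (= Borel) sigma-algebra of the library.                             *)
Section vectors.
Context {R : realType} {M : nat}.

Definition sqdist (x y : M.-tuple R) : R :=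
  \sum_(i < M) (tnth x i - tnth y i) ^+ 2.

Definition dotv (a x : M.-tuple R) : R := \sum_(i < M) tnth a i * tnth x i.
End vectors.

(* Lebesgue integral on R^n, as the iterated Lebesgue integral
   \int dx_0 \int dx_1 ... \int dx_(n-1) g (x_0, ..., x_(n-1))
   (used only for non-negative measurable integrands, for which it is the
   integral w.r.t. the n-dimensional Lebesgue measure, by Tonelli). *)
Fixpoint lebesgue_tuple_integral {R : realType} (n : nat) :
    (n.-tuple R -> \bar R) -> \bar R :=
  match n return (n.-tuple R -> \bar R) -> \bar R with
  | 0 => fun g => g [tuple]
  | n'.+1 => fun g =>
      (\int[@lebesgue_measure R]_x
         lebesgue_tuple_integral (fun t : n'.-tuple R => g [tuple of x :: t]))%E
  end.

Section random_vectors.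
Context {R : realType} {d : measure_display} {T : measurableType d}.
Variable P : probability T R.
Local Open Scope ereal_scope.

Definition finite_diff_entropy {M : nat} (X : T -> M.-tuple R) : Prop :=
  exists f : M.-tuple R -> R,
    [/\ measurable_fun [set: M.-tuple R] f,
        (forall t, (0 <= f t)%R),
        (forall A : set (M.-tuple R), measurable A ->
           P (X @^-1` A) =
           lebesgue_tuple_integral (fun t => (f t * \1_A t)%:E)) &
        lebesgue_tuple_integral (fun t => `|f t * ln (f t)|%:E) < +oo].

Definition centered_with_diag_cov {M : nat} (X : T -> M.-tuple R)
    (lam : 'I_M -> R) : Prop :=
  [/\ (forall i, P.-integrable [set: T] (fun w => ((tnth (X w) i) ^+ 2)%:E)),
      (forall i, 'E_P[fun w => tnth (X w) i] = 0) &
      (forall i j, covariance P (fun w => tnth (X w) i) (fun w => tnth (X w) j)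
                   = (if i == j then lam i else 0)%:E)].

Definition gaussian_vector {M : nat} (X : T -> M.-tuple R) : Prop :=
  forall a : M.-tuple R,
    (exists m : R, P ((fun w => dotv a (X w)) @^-1` [set m]) = 1) \/
    (exists m s : R, (0 < s)%R /\
       forall A : set R, measurable A ->
         P ((fun w => dotv a (X w)) @^-1` A) = normal_prob m s A).

Definition independent {d1 d2 : measure_display} {T1 : measurableType d1}
    {T2 : measurableType d2} (X : T -> T1) (Y : T -> T2) : Prop :=
  forall (A : set T1) (B : set T2), measurable A -> measurable B ->
    P (X @^-1` A `&` Y @^-1` B) = P (X @^-1` A) * P (Y @^-1` B).

(* Xh is drawn from the conditional distribution P(X | Z): there is a
   probability kernel k which is a (regular) conditional distribution of X
   given Z, and, conditionally on (X, Z), Xh has distribution k(Z, .). *)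
Definition drawn_from_conditional {d1 d2 : measure_display}
    {T1 : measurableType d1} {T2 : measurableType d2}
    (X : T -> T1) (Z : T -> T2) (Xh : T -> T1) : Prop :=
  exists k : R.-pker T2 ~> T1,
    (forall (B : set T1) (C : set T2), measurable B -> measurable C ->
       P (X @^-1` B `&` Z @^-1` C) = \int[P]_(w in Z @^-1` C) k (Z w) B) /\
    (forall (A B : set T1) (C : set T2),
       measurable A -> measurable B -> measurable C ->
       P (Xh @^-1` A `&` X @^-1` B `&` Z @^-1` C) =
       \int[P]_(w in X @^-1` B `&` Z @^-1` C) k (Z w) A).
End random_vectors.

Definition gamma2 {R : realType} {M : nat} (theta : R) (lam : 'I_M -> R)
  (i : 'I_M) : R := Order.min 1 (theta / lam i).

Definition noisy_observation {R : realType} {M : nat} {T : Type}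
    (theta : R) (lam : 'I_M -> R) (X U Z : T -> M.-tuple R) : Prop :=
  forall w i, tnth (Z w) i =
    Num.sqrt (1 - gamma2 theta lam i) * tnth (X w) i
    + Num.sqrt (gamma2 theta lam i) * Num.sqrt (lam i) * tnth (U w) i.

(* Rate-distortion function of a distribution mu on R^M under squared error:
   the infimum of I[X, Xh] over all joint distributions pi of (X, Xh) whose
   first marginal is mu (i.e. over all conditional distributions of Xh
   given X) such that E ||X - Xh||^2 <= D. *)
Definition rate_distortion {R : realType} {M : nat}
    (mu : probability (M.-tuple R) R) (D : \bar R) : \bar R :=
  ereal_inf [set mutual_info pi fstf
                                sndf
            | pi in [set pi : probability (M.-tuple R * M.-tuple R)%type R |
                (forall A, measurable A ->
                   distribution pi fstf A
                   = mu A) /\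
                (\int[pi]_p (sqdist p.1 p.2)%:E <= D)%E]].

(* Main.v *)
(* Stars are written s.  Let q be the density of P_(X,Z) with respect to P_X x P_Zs.  Then
   I[X,Z] + KL(P_Z || P_Zs) = E log2 q(X,Z), and as only second moments enter, this is
   the rate of the Gaussian reverse water-filling solution at level theta.  Resampling
   at most doubles the mean square error of the linear estimate of X from Z, so D/2 is
   at most the water-filling distortion at theta.  It remains to compare with the
   rate-distortion functions.  For every level th, the Donsker-Varadhan inequality with
     g(x,y) = sum_i ln(m_i/th)/2 - (x_i-y_i)^2/(2 th) + x_i^2/(2 m_i),  m_i = max(lam_i,th),
   which satisfies E exp g(Xs,y) <= 1 for all y, bounds I[X,Xh] + KL(P_X || P_Xs) from
   below by the water-filling rate as soon as Xh meets the distortion at level th.  For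
   P_X = P_Xs and th = theta this gives the first inequality; for the second, the level
   th is chosen such that its distortion is D/2, and Rs(D/2) is then at most the same
   rate, attained by the scaled output of the Gaussian channel.

   Gaussian laws are handled through the standard normal law and its product powers;
   a Gaussian vector with diagonal covariance is identified with a scaled product by
   the Cramer-Wold theorem. *)
Require Import Defs.
From HB Require Import structures.
From mathcomp Require Import all_boot all_order all_algebra.
From mathcomp Require Import all_classical all_reals all_analysis.
From mathcomp Require Import measurable_realfun.
From mathcomp Require Import ring lra.
Import Order.TTheory GRing.Theory Num.Theory.
Import numFieldNormedType.Exports.
Local Open Scope classical_set_scope.
Local Open Scope ring_scope.
Set Implicit Arguments. Unset Strict Implicit. Unset Printing Implicit Defensive.

(** * Divergence and mutual information through densities *)

(** The law of [Z] has no explicit density, but given [X = x] it is Gaussian. Taken relative to the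
    Gaussian law of [Zs], the log-density is therefore a quadratic polynomial, and its mean depends
    on second moments only. The price is a splitting [ln q = ln r + ln h], with [r] the density
    behind I[X,Z] and [h] that of P_Z, inside integrals that could be infinite. The remedy is
    [ln t >= 1 - 1/t]: negative parts of log-densities are always integrable, so a divergence is
    finite or [+oo], and integrability of the sum passes to the summands. This makes KL(P_Z || P_Zs)
    finite, as its subtraction requires.

    Above the water level the i-th term of g is the log-ratio of N(y_i, th), the backward test
    channel, to N(0, lam_i). Below it, th replaces lam_i: the logarithm vanishes and so does the
    term quadratic in x_i. As lam_i / m_i = min(lam_i, th) / th, the mean of g reaches the
    water-filling rate as soon as the total distortion is at most that of the level.

    If D = 0 and M > 0, no positive level has distortion D/2. Then the rates of all levels are lower
    bounds, and they are unbounded, so the last expression of the theorem is [+oo]. *)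

Section density.
Context {d : measure_display} {T : measurableType d} {R : realType}.
Implicit Types (nu : probability T R) (f : T -> R).
Local Open Scope ereal_scope.

(** Real-valued and non-negative everywhere, so that logarithms, inverses and products of densities
    can be formed pointwise. *)
Definition has_density nu
    (mu : {sigma_finite_measure set T -> \bar R}) f :=
  [/\ measurable_fun [set: T] f, (forall x, (0 <= f x)%R) &
      forall A, measurable A -> nu A = \int[mu]_(x in A) (f x)%:E].

Lemma has_density_dominates nu
    (mu : {sigma_finite_measure set T -> \bar R}) f : has_density nu mu f -> nu `<< mu.
Proof.
move=> [mf f0 nuE]; apply/null_content_dominatesP => A mA muA.
rewrite nuE//; apply: null_set_integral => //.
exact/measurable_EFinP/measurable_funTS.
Qed.

Lemma has_density_ae_RN nu
    (mu : {sigma_finite_measure set T -> \bar R}) f : has_density nu mu f ->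
  ae_eq mu [set: T] (Radon_Nikodym_SigmaFinite.f nu mu) (EFin \o f).
Proof.
move=> nuf; have numu := has_density_dominates nuf; have [mf f0 nuE] := nuf.
apply: integral_ae_eq => //.
- exact: Radon_Nikodym_SigmaFinite.f_integrable.
- exact/measurable_EFinP.
- move=> A _ mA; rewrite -Radon_Nikodym_SigmaFinite.f_integral//; exact: nuE.
Qed.

Lemma ge0_integral_density nu
    (mu : {sigma_finite_measure set T -> \bar R}) f (g : T -> \bar R) : has_density nu mu f ->
  measurable_fun [set: T] g -> (forall x, 0 <= g x) ->
  \int[nu]_x g x = \int[mu]_x (g x * (f x)%:E).
Proof.
move=> nuf mg g0; have numu := has_density_dominates nuf.
have [mf f0 nuE] := nuf.
rewrite -(Radon_Nikodym_SigmaFinite.change_of_variables numu)//.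
apply: ae_eq_integral => //.
- apply: emeasurable_funM => //.
  exact: measurable_int (Radon_Nikodym_SigmaFinite.f_integrable numu).
- by apply: emeasurable_funM => //; exact/measurable_EFinP.
- by apply: ae_eqe_mul2l; exact: has_density_ae_RN.
Qed.

Lemma dominates_has_density nu (mu : probability T R) : nu `<< mu -> exists f, has_density nu mu f.
Proof.
move=> numu; pose h := Radon_Nikodym_SigmaFinite.f nu mu.
have hfin x : h x \is a fin_num by exact: Radon_Nikodym_SigmaFinite.f_fin_num.
have mh : measurable_fun [set: T] h.
  exact: measurable_int (Radon_Nikodym_SigmaFinite.f_integrable numu).
exists (fine \o h); split.
- exact: measurableT_comp.
- by move=> x; apply/fine_ge0; exact: Radon_Nikodym_SigmaFinite.f_ge0.
- move=> A mA; rewrite (Radon_Nikodym_SigmaFinite.f_integral numu)//.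
  by apply: eq_integral => x _ /=; rewrite fineK.
Qed.

Lemma measurable_log2 (f : T -> R) : measurable_fun [set: T] f ->
  measurable_fun [set: T] (fun x => log2 (f x)).
Proof.
move=> mf; apply: measurable_funM => //.
by apply: measurableT_comp => //; exact: measurable_ln.
Qed.

(** Densities agree [mu]-almost everywhere, hence [nu]-almost everywhere by domination; so any
    version may replace the Radon-Nikodym derivative in [KL]. *)
Lemma KL_density nu (mu : probability T R) f : has_density nu mu f ->
  KL nu mu = \int[nu]_x (log2 (f x))%:E.
Proof.
move=> nuf; have numu := has_density_dominates nuf; have [mf f0 nuE] := nuf.
rewrite /KL; case: pselect => [numu'|//] /=.
have mRN : measurable_fun [set: T]
    (Radon_Nikodym (charge_of_finite_measure nu) mu).
  by apply: (measurable_int mu); exact: Radon_Nikodym_integrable.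
apply: ae_eq_integral => //.
- apply/measurable_EFinP/measurable_log2; exact: measurableT_comp.
- exact/measurable_EFinP/measurable_log2.
- have h : ae_eq mu [set: T] (Radon_Nikodym (charge_of_finite_measure nu) mu)
      (EFin \o f).
    apply: ae_eq_trans (has_density_ae_RN nuf).
    exact/ae_eq_sym/ae_eq_Radon_Nikodym_SigmaFinite.
  have h' : ae_eq nu [set: T] (Radon_Nikodym (charge_of_finite_measure nu) mu)
      (EFin \o f) by exact: (null_dominates_ae_eq measurableT numu h).
  by apply: filterS h' => x /= + xT => /(_ xT) ->.
Qed.

(** The [nu]-measure of the zero set of [f] is the integral of [f] over it, which is 0. *)
Lemma has_density_ae_gt0 nu (mu : probability T R) f : has_density nu mu f ->
  {ae nu, forall x, (0 < f x)%R}.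
Proof.
move=> [mf f0 nuE]; exists (f @^-1` [set 0%R]).
have mA : measurable (f @^-1` [set 0%R]).
  by rewrite -[X in measurable X]setTI; apply: mf => //; exact: measurable_set1.
split => //.
  rewrite nuE// (eq_integral (cst 0)) ?integral0// => x.
  by rewrite inE /= => ->.
move=> x /= /negP; rewrite -leNgt => fx; apply/eqP.
by rewrite eq_le fx f0.
Qed.

Lemma ln2_gt0 : (0 < ln 2 :> R)%R. Proof. by rewrite ln_gt0// ltr1n. Qed.

(** This is [ln (1 + x) <= x] at [x = t^-1 - 1]. *)
Lemma log2_ge (t : R) : (0 < t)%R -> ((1 - t^-1) / ln 2 <= log2 t)%R.
Proof.
move=> t0; rewrite /log2 ler_pM2r ?invr_gt0 ?ln2_gt0//.
have t1 : (-1 < t^-1 - 1)%R by rewrite ltrBDr addrC subrr invr_gt0.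
have := le_ln1Dx t1; rewrite addrC subrK lnV ?posrE//; lra.
Qed.

Lemma measurable_funV_ge0 (f : T -> R) : measurable_fun [set: T] f ->
  (forall x, (0 <= f x)%R) -> measurable_fun [set: T] (fun x => ((f x)^-1)%R).
Proof.
move=> mf f0; rewrite (_ : (fun x => _) = (fun x => powR (f x) (-1))).
  by have mp := @measurable_powR R (-1)%R; exact: (measurableT_comp mp mf).
by apply/funext => x; rewrite powR_inv1.
Qed.

(** After the change of measure the integrand is [(f x)^-1 * f x], which is 1, or 0 where [f]
    vanishes; hence an inequality only. *)
Lemma integral_inv_density nu (mu : probability T R) f : has_density nu mu f ->
  \int[nu]_x ((f x)^-1)%:E <= 1.
Proof.
move=> nuf; have [mf f0 nuE] := nuf.
rewrite (ge0_integral_density nuf)//; last 2 first.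
- by apply/measurable_EFinP/measurable_funV_ge0.
- by move=> x; rewrite lee_fin invr_ge0.
rewrite -[leRHS](_ : \int[mu]_x (cst 1%E) x = 1); last first.
  by rewrite integral_cst// mul1e; exact: probability_setT.
apply: ge0_le_integral => //.
- by move=> x _; rewrite -EFinM lee_fin mulr_ge0// invr_ge0.
- by apply/measurable_EFinP/measurable_funM => //; exact: measurable_funV_ge0.
- move=> x _; rewrite -EFinM lee_fin; have [->|fx] := eqVneq (f x) 0%R.
    by rewrite mulr0.
  by rewrite mulVf.
Qed.

(** By [log2_ge] the negative part is at most [(f x)^-1 / ln 2], whose integral is bounded by the
    previous lemma. Where [f] vanishes, [ln 0 = 0] makes the bound trivial. *)
Lemma negpart_log2_density nu (mu : probability T R) f : has_density nu mu f ->
  \int[nu]_x (fun x => (log2 (f x))%:E)^\- x < +oo.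
Proof.
move=> nuf; have [mf f0 nuE] := nuf.
have c0 : (0 <= (ln 2 :> R)^-1)%R by rewrite invr_ge0 ltW// ln2_gt0.
have mi : measurable_fun [set: T] (fun x => ((f x)^-1)%:E).
  by apply/measurable_EFinP/measurable_funV_ge0.
apply: (@le_lt_trans _ _ (\int[nu]_x ((ln 2 :> R)^-1%:E * ((f x)^-1)%:E))).
  apply: ge0_le_integral => //.
  - exact/measurable_funeneg/measurable_EFinP/measurable_log2.
  - exact: measurable_funeM.
  - move=> x _; rewrite funenegE -EFinM -EFinN -EFin_max lee_fin ge_max.
    apply/andP; split; last by rewrite mulr_ge0// invr_ge0.
    have := f0 x; rewrite le_eqVlt => /predU1P[<-|fx].
      by rewrite /log2 ln0// mul0r oppr0 invr0 mulr0.
    rewrite lerNl (le_trans _ (log2_ge fx))// mulrBl mul1r mulrC.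
    by rewrite lerBrDr addrC subrr.
rewrite ge0_integralZl//; last by move=> x _; rewrite lee_fin invr_ge0.
rewrite (@le_lt_trans _ _ ((ln 2 :> R)^-1%:E * 1))//; last by rewrite mule1 ltry.
by apply: lee_wpmul2l; [rewrite lee_fin|exact: integral_inv_density nuf].
Qed.

End density.

Section quasi_integral.
Context {d : measure_display} {T : measurableType d} {R : realType}.
Variable mu : probability T R.
Local Open Scope ereal_scope.

(** A finite negative part excludes both the value [-oo] and an undefined difference of
    infinities. *)
Lemma integrable_or_pinfty (h : T -> \bar R) : measurable_fun [set: T] h ->
  \int[mu]_x h^\- x < +oo ->
  mu.-integrable [set: T] h \/ \int[mu]_x h x = +oo.
Proof.
move=> mh hn.
have n0 : 0 <= \int[mu]_x h^\- x by exact: integral_ge0.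
have p0 : 0 <= \int[mu]_x h^\+ x by exact: integral_ge0.
have nfin : \int[mu]_x h^\- x \is a fin_num by rewrite ge0_fin_numE.
have [hp|hp] := ltP (\int[mu]_x h^\+ x) +oo.
  left; apply/integrableP; split=> //.
  rewrite (eq_integral (h^\+ \+ h^\-)); last by move=> x _; rewrite -[`|h x|]/((abse \o h) x) fune_abse.
  by rewrite ge0_integralD//; [rewrite lte_add_pinfty|exact: measurable_funepos
    |exact: measurable_funeneg].
right; rewrite integralE; move: hp; rewrite leye_eq => /eqP ->.
by rewrite addye//; case: (\int[mu]_x _) nfin.
Qed.

(** From [f = (f + g) - g] one gets [f^+ <= |f + g| + g^- + f^-]; adding [f^-] bounds [|f|] by
    integrable terms. *)
Lemma negpart_add_integrable (f g : T -> R) :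
  measurable_fun [set: T] f -> measurable_fun [set: T] g ->
  \int[mu]_x (EFin \o f)^\- x < +oo -> \int[mu]_x (EFin \o g)^\- x < +oo ->
  mu.-integrable [set: T] (fun x => (f x + g x)%:E) ->
  mu.-integrable [set: T] (EFin \o f).
Proof.
move=> mf mg fn gn fg; apply/integrableP; split; first exact/measurable_EFinP.
have mF : measurable_fun [set: T] (EFin \o f) by exact/measurable_EFinP.
have mG : measurable_fun [set: T] (EFin \o g) by exact/measurable_EFinP.
have mn : measurable_fun [set: T] (fun x => (EFin \o f)^\- x + (EFin \o g)^\- x).
  by apply: emeasurable_funD; exact: measurable_funeneg.
apply: (@le_lt_trans _ _ (\int[mu]_x (`|(f x + g x)%:E| +
   (((EFin \o f)^\- x + (EFin \o g)^\- x) + (EFin \o f)^\- x)))).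
  apply: ge0_le_integral => //.
  - by apply: measurableT_comp.
  - apply: emeasurable_funD; last first.
      by apply: emeasurable_funD => //; exact: measurable_funeneg.
    by apply: measurableT_comp => //; exact/measurable_EFinP/measurable_funD.
  - move=> x _; rewrite !funenegE /= -!EFin_max -!EFinD lee_fin.
    have := ler_norm (f x + g x); have := ler_norm (- (f x + g x)).
    rewrite normrN /Num.max; case: ltP => ?; case: ltP => ?; case: (ger0P (f x)) => ?; lra.
rewrite ge0_integralD//; last 3 first.
- by apply: measurableT_comp => //; exact/measurable_EFinP/measurable_funD.
- by move=> x _; rewrite !adde_ge0.
- by apply: emeasurable_funD => //; exact: measurable_funeneg.
rewrite lte_add_pinfty//; first by case/integrableP : fg.
rewrite ge0_integralD//; last 2 first.
- by move=> x _; rewrite adde_ge0.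
- exact: measurable_funeneg.
rewrite lte_add_pinfty// ge0_integralD//; last 2 first.
- exact: measurable_funeneg.
- exact: measurable_funeneg.
by rewrite lte_add_pinfty.
Qed.

End quasi_integral.

Lemma integral_prob_cst (R : realType) d (T : measurableType d)
    (P : probability T R) (r : R) : (\int[P]_w r%:E = r%:E)%E.
Proof.
rewrite integral_cst//.
by transitivity (r%:E * 1)%E; [congr (_ * _)%E; exact: probability_setT|rewrite mule1].
Qed.

(** * Lower bounds on mutual information from test functions *)

Section certificate.
Context {d1 d2 d : measure_display} {T1 : measurableType d1}
  {T2 : measurableType d2} {T : measurableType d} {R : realType}.
Local Open Scope ereal_scope.

Lemma KL_gtNy d0 (T0 : measurableType d0) (nu mu : probability T0 R) :
  -oo < KL nu mu.
Proof.
have [/dominates_has_density[f nuf]|h] := pselect (nu `<< mu); last first.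
  by rewrite /KL; case: pselect => //= _; rewrite ltNyr.
rewrite (KL_density nuf); have [mf _ _] := nuf.
have [|/(integrable_fin_num measurableT)|->] := @integrable_or_pinfty _ _ _ nu
  (fun x => (log2 (f x))%:E) _ (negpart_log2_density nuf).
- exact/measurable_EFinP/measurable_log2.
- by move=> /fineK <-; rewrite ltNyr.
- by [].
Qed.

Variables (P : probability T R) (X : {mfun T >-> T1}) (Y : {mfun T >-> T2})
  (mus : probability T1 R) (g : T1 * T2 -> R).
Hypothesis mg : measurable_fun [set: T1 * T2] g.
Hypothesis g1 : forall y, \int[mus]_x (expR (g (x, y)))%:E <= 1.
Hypothesis gint : P.-integrable [set: T] (fun w => (g (X w, Y w))%:E).

Let J : probability _ R := distribution P (pairf X Y).
Let mX : probability _ R := distribution P X.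
Let mY : probability _ R := distribution P Y.
Let mXY : probability _ R := mX \x mY.

Let marginal_integral (h : T1 -> \bar R) : measurable_fun [set: T1] h ->
  (forall x, 0 <= h x) -> \int[J]_p h p.1 = \int[mX]_x h x.
Proof.
move=> mh h0; rewrite !ge0_integral_distribution//.
exact: measurableT_comp.
Qed.

(** Integrating against [J] and dividing by [r] leads to [mX \x mY], then dividing by [s] leads from
    [mX] to [mus], each time with [<=] because of the zeros of the density. What remains is [g1]
    averaged over [y]. *)
Lemma certificate_density (r : T1 * T2 -> R) (s : T1 -> R) :
  has_density J mXY r -> has_density mX mus s ->
  \int[J]_p (expR (g p) / (r p * s p.1))%:E <= 1.
Proof.
move=> Jr Xs; have [mr r0 _] := Jr; have [ms s0 _] := Xs.
have ms1 : measurable_fun [set: T1 * T2] (fun p => s p.1).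
  exact: (measurableT_comp ms measurable_fst).
have me : measurable_fun [set: T1 * T2] (fun p => expR (g p)).
  exact: (measurableT_comp (@measurable_expR R) mg).
rewrite (ge0_integral_density Jr); last 2 first.
- apply/measurable_EFinP/measurable_funM => //.
  by apply: measurable_funV_ge0 => [|x]; [exact: measurable_funM|rewrite mulr_ge0].
- by move=> x; rewrite lee_fin divr_ge0 ?expR_ge0 ?mulr_ge0.
have m2 : measurable_fun [set: T1 * T2] (fun p => (expR (g p) / s p.1)%:E).
  by apply/measurable_EFinP/measurable_funM => //; exact: measurable_funV_ge0.
apply: (@le_trans _ _ (\int[mX \x mY]_p (expR (g p) / s p.1)%:E)).
  apply: ge0_le_integral => //.
  - by move=> x _; rewrite -EFinM lee_fin !mulr_ge0 ?expR_ge0 ?invr_ge0 ?mulr_ge0.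
  - apply/measurable_EFinP/measurable_funM => //; apply: measurable_funM => //.
    by apply: measurable_funV_ge0 => [|x]; [exact: measurable_funM|rewrite mulr_ge0].
  - move=> x _; rewrite -EFinM lee_fin; have [->|rx] := eqVneq (r x) 0%R.
      by rewrite mulr0 divr_ge0 ?expR_ge0.
    by rewrite invfM mulrA mulrAC mulfVK.
rewrite (fubini_tonelli2 _ m2); last first.
  by move=> x; rewrite lee_fin divr_ge0 ?expR_ge0.
apply: (@le_trans _ _ (\int[mY]_y (cst 1 y))); last first.
  by rewrite integral_cst// mul1e; rewrite le_eqVlt; apply/orP; left; apply/eqP;
    exact: probability_setT.
apply: ge0_le_integral => //.
- by move=> y _; apply: integral_ge0 => x _; rewrite lee_fin divr_ge0 ?expR_ge0.
- by apply: measurable_fun_fubini_tonelli_G => // x; rewrite lee_fin divr_ge0 ?expR_ge0.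
- move=> y _; apply: le_trans (g1 y).
  have mey : measurable_fun [set: T1] (fun x => expR (g (x, y))).
    exact: (measurableT_comp me (measurable_pair2 y)).
  have mV : measurable_fun [set: T1] (fun x => (s x)^-1)%R.
    exact: measurable_funV_ge0.
  rewrite /fubini_G (ge0_integral_density Xs)/=; last 2 first.
  + by apply/measurable_EFinP/measurable_funM.
  + by move=> x; rewrite lee_fin divr_ge0 ?expR_ge0.
  apply: ge0_le_integral => //.
  + by move=> x _; rewrite -EFinM lee_fin !mulr_ge0 ?expR_ge0 ?invr_ge0.
  + by apply/measurable_EFinP/measurable_funM => //; exact: measurable_funM.
  + exact/measurable_EFinP.
  + move=> x _; rewrite -EFinM lee_fin; have [->|sx] := eqVneq (s x) 0%R.
      by rewrite mulr0 expR_ge0.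
    by rewrite mulfVK.
Qed.

(* Donsker-Varadhan: E[ln (dJ/d(mus x mY)) - g] >= E[1 - e^g / (dJ/d(mus x mY))] >= 0. *)
Lemma mutual_info_KL_ge :
  \int[P]_w (g (X w, Y w) / ln 2)%:E <= mutual_info P X Y + KL mX mus.
Proof.
have I0 : -oo < mutual_info P X Y by exact: KL_gtNy.
have K0 := KL_gtNy mX mus.
rewrite /mutual_info in I0 *.
(* If one of the two divergences is [+oo], so is their sum, the other one being above [-oo]. *)
have [/dominates_has_density[r Jr]|h] := pselect (J `<< (mX \x mY)); last first.
  rewrite [X in X + _](_ : _ = +oo); last by rewrite /KL; case: pselect.
  by rewrite addye ?leey// gt_eqF.
have [/dominates_has_density[s Xs]|h] := pselect (mX `<< mus); last first.
  rewrite [X in _ + X](_ : _ = +oo); last by rewrite /KL; case: pselect.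
  by rewrite addey ?leey// gt_eqF.
rewrite (KL_density Jr) (KL_density Xs) in I0 K0 *.
have [mr r0 JrE] := Jr; have [ms s0 XsE] := Xs.
have mlr : measurable_fun [set: T1 * T2] (fun p => (log2 (r p))%:E).
  exact/measurable_EFinP/measurable_log2.
have mls : measurable_fun [set: T1] (fun p => (log2 (s p))%:E).
  exact/measurable_EFinP/measurable_log2.
have [ilr|->] := integrable_or_pinfty mlr (negpart_log2_density Jr); last first.
  by rewrite addye ?leey// gt_eqF.
have [ils|->] := integrable_or_pinfty mls (negpart_log2_density Xs); last first.
  by rewrite addey ?leey// gt_eqF.
have mls1 : measurable_fun [set: T1 * T2] (fun p => (log2 (s p.1))%:E).
  exact: (measurableT_comp mls measurable_fst).
have ils1 : J.-integrable [set: T1 * T2] (fun p => (log2 (s p.1))%:E).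
  apply/integrableP; split => //.
  rewrite (marginal_integral (h := fun x => `|(log2 (s x))%:E|))//.
    by case/integrableP : ils.
  exact: measurableT_comp.
have c0 : (0 < (ln 2 :> R)^-1)%R by rewrite invr_gt0 ln2_gt0.
have ils2 : P.-integrable [set: T] (fun w => (log2 (s (X w)))%:E).
  apply/integrableP; split; first exact: measurableT_comp mls _.
  case/integrableP : ils => _.
  by rewrite ge0_integral_distribution//; exact: measurableT_comp.
have -> : \int[mX]_x (log2 (s x))%:E = \int[J]_p (log2 (s p.1))%:E.
  by rewrite !integral_distribution.
have mc : measurable_fun [set: T1 * T2] (fun p => (g p / ln 2)%:E).
  by apply/measurable_EFinP/measurable_funM.
have igP : P.-integrable [set: T] (fun w => (g (X w, Y w) / ln 2)%:E).
  under eq_fun do rewrite EFinM.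
  exact: integrableZr.
have ig : J.-integrable [set: T1 * T2] (fun p => (g p / ln 2)%:E).
  apply/integrableP; split => //; case/integrableP : igP => _.
  by rewrite ge0_integral_distribution//; exact: measurableT_comp.
have -> : \int[P]_w (g (X w, Y w) / ln 2)%:E = \int[J]_p (g p / ln 2)%:E.
  by rewrite integral_distribution.
pose u0 p := (expR (g p) / (r p * s p.1))%R.
have u0_ge0 p : (0 <= u0 p)%R by rewrite divr_ge0 ?expR_ge0// mulr_ge0.
have mu0 : measurable_fun [set: T1 * T2] u0.
  have ms1 : measurable_fun [set: T1 * T2] (fun p => s p.1).
    exact: (measurableT_comp ms measurable_fst).
  apply: measurable_funM; first exact: (measurableT_comp (@measurable_expR R) mg).
  by apply: measurable_funV_ge0 => [|x]; [exact: measurable_funM|rewrite mulr_ge0].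
have iu0 : J.-integrable [set: T1 * T2] (fun p => (u0 p)%:E).
  apply/integrableP; split; first exact/measurable_EFinP.
  under eq_integral do rewrite gee0_abs ?lee_fin//.
  by apply: le_lt_trans (certificate_density Jr Xs) _; rewrite ltry.
have iu : J.-integrable [set: T1 * T2] (fun p => (u0 p / ln 2)%:E).
  by under eq_fun do rewrite EFinM; exact: integrableZr.
have u1 : \int[J]_p (u0 p / ln 2)%:E <= ((ln 2)^-1)%:E.
  under eq_integral do rewrite EFinM.
  rewrite integralZr// -[leRHS]mul1e; apply: lee_wpmul2r.
    by rewrite lee_fin ltW.
  exact: certificate_density Jr Xs.
(* [v] is the gap in [log2_ge] at [t = r p * s p.1 / expR (g p)], whose inverse is [u0 p]. *)
pose v p := (log2 (r p) + log2 (s p.1) + u0 p / ln 2 - (g p / ln 2 + (ln 2)^-1))%R.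
have v0 : 0 <= \int[J]_p (v p)%:E.
  (* [log2_ge] needs [r] and [s] positive, which holds [J]-almost everywhere only; there [v] equals
     its absolute value. *)
  rewrite (ae_eq_integral (fun p => `|(v p)%:E|)) ?integral_ge0//.
  - apply/measurable_EFinP/measurable_funB; last first.
      by apply: measurable_funD => //; exact/measurable_EFinP.
    apply: measurable_funD; last by apply: measurable_funM.
    by apply: measurable_funD; exact/measurable_EFinP.
  - apply: measurableT_comp => //.
    apply/measurable_EFinP/measurable_funB; last first.
      by apply: measurable_funD => //; exact/measurable_EFinP.
    apply: measurable_funD; last by apply: measurable_funM.
    by apply: measurable_funD; exact/measurable_EFinP.
  - have Hr := has_density_ae_gt0 Jr.
    have Hs : {ae J, forall p, (0 < s p.1)%R}.
      have [N [mN N0 sN]] := has_density_ae_gt0 Xs.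
      exists (fst @^-1` N); split.
      + by rewrite -[X in measurable X]setTI; exact: measurable_fst.
      + exact: N0.
      + by move=> p /= /sN.
    apply: filterS2 Hr Hs => p rp sp _ /=.
    rewrite ger0_norm// /v.
    have qp : (0 < r p * s p.1 / expR (g p))%R by rewrite divr_gt0 ?mulr_gt0 ?expR_gt0.
    have := log2_ge qp.
    rewrite {1}/log2 ln_div ?posrE ?mulr_gt0 ?expR_gt0// expRK lnM ?posrE//.
    rewrite invf_div /log2 -/(u0 p); lra.
have vE : \int[J]_p (v p)%:E = \int[J]_p (log2 (r p))%:E + \int[J]_p (log2 (s p.1))%:E
    + \int[J]_p (u0 p / ln 2)%:E - (\int[J]_p (g p / ln 2)%:E + ((ln 2)^-1)%:E).
  under eq_integral do rewrite /v EFinB !EFinD.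
  have icst : J.-integrable [set: T1 * T2] (fun=> ((ln 2)^-1)%:E).
    exact: finite_measure_integrable_cst.
  rewrite integralB//; [|by do 2?apply: integrableD|exact: integrableD].
  rewrite integralD//; last exact: integrableD.
  rewrite integralD// integralD//; congr (_ - (_ + _)).
  transitivity ((ln 2 :> R)^-1%:E * 1); last by rewrite mule1.
  by rewrite integral_cst//; congr (_ * _); exact: probability_setT.
rewrite vE in v0; move: v0 u1.
have /fineK <- := integrable_fin_num measurableT ilr.
have /fineK <- := integrable_fin_num measurableT ils1.
have /fineK <- := integrable_fin_num measurableT iu.
have /fineK <- := integrable_fin_num measurableT ig.
rewrite -!EFinD -?EFinN -?EFinD !lee_fin; lra.
Qed.
End certificate.

(** * The standard normal law *)

Section affine_lebesgue.
Context {R : realType}.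
Local Open Scope ereal_scope.
Notation leb := (@lebesgue_measure R).

Section pushforward.
Variables (a b : R).
Definition affine_map : measurableTypeR R -> measurableTypeR R :=
  fun u => (a + b * u)%R.

Lemma measurable_affine_map : measurable_fun [set: measurableTypeR R] affine_map.
Proof.
by apply: measurable_funD => //; apply: measurable_funM.
Qed.

HB.instance Definition _ :=
  @isMeasurableFun.Build _ _ _ _ affine_map measurable_affine_map.
End pushforward.

(** The image of Lebesgue measure under the affine map, multiplied by [b], gives half-open intervals
    their length, so it is Lebesgue measure by uniqueness. *)
Lemma lebesgue_affine (a b : R) (F : R -> \bar R) : (0 < b)%R ->
  measurable_fun [set: R] F -> (forall x, 0 <= F x) ->
  \int[leb]_u (F (a + b * u)%R * b%:E) = \int[leb]_x F x.
Proof.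
move=> b0 mF F0; have b0' := ltW b0.
pose push := measure_function_pushforward__canonical__measure_function_Measure
  leb (measurable_affine_map a b).
transitivity (\int[mscale (NngNum b0') push]_x F x).
  rewrite (ge0_integral_mscale push)// /push.
  rewrite (ge0_integral_pushforward (measurable_affine_map a b))//.
  rewrite ge0_integralZr//.
    by rewrite muleC.
  exact: (measurableT_comp mF (measurable_affine_map a b)).
apply: eq_measure_integral => /= A mA _.
apply/esym/lebesgue_measure_unique => //= _ [[u v]] _ <-.
rewrite /mscale/= /pushforward/=.
rewrite (_ : affine_map a b @^-1` _ = `]((u - a) / b)%R, ((v - a) / b)%R]%classic); last first.
  apply/seteqP; split=> x /=; rewrite !in_itv/= /affine_map ltr_pdivrMr// ler_pdivlMr//;
    rewrite (mulrC b) ltrBlDl lerBrDl//.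
rewrite !lebesgue_measure_itv/= !lte_fin ltr_pM2r ?invr_gt0// ltrD2r.
case: ifPn => _; last by rewrite mule0.
rewrite -!EFinB -EFinM; congr EFin; field; exact: lt0r_neq0.
Qed.

Lemma lebesgue_opp (F : R -> \bar R) :
  measurable_fun [set: R] F -> (forall x, 0 <= F x) ->
  \int[leb]_u F (- u)%R = \int[leb]_x F x.
Proof.
move=> mF F0.
transitivity (\int[pushforward leb (-%R : _ -> measurableTypeR R)]_x F x).
  by rewrite ge0_integral_pushforward//.
by apply: eq_measure_integral => /= A mA _; exact: lebesgue_measureN.
Qed.
End affine_lebesgue.

Section standard_gaussian.
Context {R : realType}.
Local Open Scope ereal_scope.
Notation leb := (@lebesgue_measure R).

Let idR : measurableTypeR R -> R := idfun.
#[local] HB.instance Definition _ :=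
  @isMeasurableFun.Build _ _ _ _ idR (@measurable_id _ _ setT).

(* [normal_prob 0 1], on the canonical sigma-algebra of [R] instead of [measurableTypeR R]. *)
Definition std_gauss : probability R R :=
  distribution (normal_prob 0 1 : probability _ R) idR.

Lemma ge0_integral_normal_prob (m s : R) (F : R -> \bar R) : s != 0%R ->
  measurable_fun [set: R] F -> (forall x, 0 <= F x) ->
  \int[normal_prob m s]_x F x = \int[leb]_x (F x * (normal_pdf m s x)%:E).
Proof.
move=> s0 mF F0.
apply: (@ge0_integral_density _ _ R (normal_prob m s : probability _ R) leb) => //.
split=> //; first exact: measurable_normal_pdf.
by move=> x; exact: normal_pdf_ge0.
Qed.

Let c := @normal_peak R 1.

Lemma normal_pdf_gauss (m s x : R) : (0 < s)%R ->
  normal_pdf m s x = (c / s * expR (- (x - m) ^+ 2 / (2 * s ^+ 2)))%R.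
Proof.
move=> s0; rewrite normal_pdfE ?gt_eqF// /normal_fun; congr (_ * _)%R; last first.
  by rewrite -mulr_natl.
rewrite /c /normal_peak expr1n mul1r -mulrnAr sqrtrM ?sqr_ge0// sqrtr_sqr gtr0_norm//.
by rewrite invfM mulrC.
Qed.

Lemma ge0_integral_std_gauss (F : R -> \bar R) :
  measurable_fun [set: R] F -> (forall x, 0 <= F x) ->
  \int[std_gauss]_x F x = \int[leb]_x (F x * (c * expR (- x ^+ 2 / 2))%:E).
Proof.
move=> mF F0; rewrite ge0_integral_distribution// ge0_integral_normal_prob//.
by apply: eq_integral => x _; rewrite /= normal_pdf_gauss// divr1 subr0 expr1n mulr1.
Qed.

Lemma ge0_integral_normal_probE (m s : R) (F : R -> \bar R) : (0 < s)%R ->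
  measurable_fun [set: R] F -> (forall x, 0 <= F x) ->
  \int[normal_prob m s]_x F x = \int[std_gauss]_x F (m + s * x)%R.
Proof.
move=> s0 mF F0; rewrite ge0_integral_normal_prob ?gt_eqF//.
have m1 : measurable_fun [set: R] (fun u => m + s * u)%R.
  exact: measurable_affine_map.
have mp : measurable_fun [set: R] (fun x => F x * (normal_pdf m s x)%:E).
  by apply: emeasurable_funM => //; apply/measurable_EFinP; exact: measurable_normal_pdf.
rewrite ge0_integral_std_gauss//; last exact: (measurableT_comp mF m1).
rewrite -(lebesgue_affine m s0 mp); last first.
  by move=> x; rewrite mule_ge0// lee_fin normal_pdf_ge0.
apply: eq_integral => x _; rewrite -muleA -EFinM; congr (_ * EFin _).
rewrite normal_pdf_gauss// mulrAC divfK ?gt_eqF//; congr (_ * expR _)%R.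
by field; rewrite gt_eqF.
Qed.

(* [dN(a, b^2) / dN(0, s^2)] at [z]. *)
Definition normal_ratio (a b s z : R) : R :=
  (s / b * expR (z ^+ 2 / (2 * s ^+ 2) - (z - a) ^+ 2 / (2 * b ^+ 2)))%R.

Lemma normal_ratio_gt0 a b s z : (0 < b)%R -> (0 < s)%R -> (0 < normal_ratio a b s z)%R.
Proof. by move=> b0 s0; rewrite !mulr_gt0 ?invr_gt0 ?expR_gt0. Qed.

(** Both sides are the integral of [F] under N(a, b^2); on the right the reference law is N(0, s^2),
    written as the image of the standard normal law under multiplication by [s]. *)
Lemma std_gauss_shift (a b s : R) (F : R -> \bar R) : (0 < b)%R -> (0 < s)%R ->
  measurable_fun [set: R] F -> (forall x, 0 <= F x) ->
  \int[std_gauss]_u F (a + b * u)%R =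
  \int[std_gauss]_u (F (s * u)%R * (normal_ratio a b s (s * u)%R)%:E).
Proof.
move=> b0 s0 mF F0; rewrite -ge0_integral_normal_probE// ge0_integral_normal_prob ?gt_eqF//.
have mp : measurable_fun [set: R] (fun x => F x * (normal_pdf a b x)%:E).
  by apply: emeasurable_funM => //; apply/measurable_EFinP; exact: measurable_normal_pdf.
have ms : measurable_fun [set: R] (fun u => s * u)%R by exact: measurable_funM.
rewrite ge0_integral_std_gauss//; last 2 first.
- apply: emeasurable_funM; first exact: (measurableT_comp mF ms).
  apply/measurable_EFinP/measurable_funM => //.
  apply: (measurableT_comp (@measurable_expR R)).
  apply: measurable_funB; apply: measurable_funM => //; apply: measurable_funX => //.
  exact: measurable_funB.
- by move=> u; rewrite mule_ge0// lee_fin ltW// normal_ratio_gt0.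
rewrite -(lebesgue_affine 0 s0 mp); last first.
  by move=> x; rewrite mule_ge0// lee_fin normal_pdf_ge0.
apply: eq_integral => x _; rewrite add0r -!muleA -!EFinM; congr (_ * EFin _).
rewrite normal_pdf_gauss// /normal_ratio.
rewrite [RHS](_ : _ = c / b * s * (expR ((s * x) ^+ 2 / (2 * s ^+ 2) -
  (s * x - a) ^+ 2 / (2 * b ^+ 2)) * expR (- x ^+ 2 / 2)))%R; last by ring.
rewrite -expRD mulrAC; congr (_ * expR _)%R.
by field; rewrite !gt_eqF.
Qed.

Lemma integral_normal_ratio (a b s : R) : (0 < b)%R -> (0 < s)%R ->
  \int[std_gauss]_u (normal_ratio a b s (s * u)%R)%:E = 1.
Proof.
move=> b0 s0; have := @std_gauss_shift a b s (cst 1) b0 s0 (measurable_cst _) (fun=> lee01).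
under [X in _ = X]eq_integral do rewrite mul1e.
move=> <-; rewrite integral_cst// mul1e; exact: probability_setT.
Qed.

Lemma std_gauss_opp (F : R -> \bar R) :
  measurable_fun [set: R] F -> (forall x, 0 <= F x) ->
  \int[std_gauss]_u F (- u)%R = \int[std_gauss]_u F u.
Proof.
move=> mF F0; rewrite !ge0_integral_std_gauss//; last exact: (measurableT_comp mF).
rewrite -lebesgue_opp.
- by apply: eq_integral => x _; rewrite opprK sqrrN.
- apply: emeasurable_funM; first exact: (measurableT_comp mF).
  apply/measurable_EFinP/measurable_funM => //.
  apply: (measurableT_comp (@measurable_expR R)).
  apply: measurable_funM => //; apply: measurableT_comp => //; exact: measurable_funX.
- by move=> x; rewrite mule_ge0// lee_fin mulr_ge0 ?expR_ge0// normal_peak_ge0.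
Qed.

End standard_gaussian.

Section gaussian_rotation.
Context {R : realType}.
Local Open Scope ereal_scope.
Notation g := (@std_gauss R).

Lemma measurable_normal_ratio (d : measure_display) (T : measurableType d)
    (a z : T -> R) (b s : R) : measurable_fun [set: T] a -> measurable_fun [set: T] z ->
  measurable_fun [set: T] (fun p => normal_ratio (a p) b s (z p)).
Proof.
move=> ma mz; apply: measurable_funM => //.
apply: (measurableT_comp (@measurable_expR R)).
apply: measurable_funB; apply: measurable_funM => //; apply: measurable_funX => //.
exact: measurable_funB.
Qed.

Lemma std_gauss_scale_norm (s : R) (F : R -> \bar R) :
  measurable_fun [set: R] F -> (forall x, 0 <= F x) ->
  \int[g]_u F (`|s| * u)%R = \int[g]_u F (s * u)%R.
Proof.
move=> mF F0; have [s0|s0] := ger0P s; first by [].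
rewrite -(@std_gauss_opp R (fun u => F (s * u)%R)).
- by under eq_integral do rewrite mulNr -mulrN.
- by apply: (measurableT_comp mF); exact: measurable_funM.
- by [].
Qed.

(** For fixed [x] the argument of [F] has law N(s x, t^2). It is expressed relative to the claimed
    law N(0, q^2), and after exchanging the integrals the ratio integrates to 1 over [x]. *)
Lemma std_gauss_rotation_gt0 (s t : R) (F : R -> \bar R) : (s != 0)%R -> (0 < t)%R ->
  measurable_fun [set: R] F -> (forall x, 0 <= F x) ->
  \int[g]_x \int[g]_y F (s * x + t * y)%R =
  \int[g]_u F (Num.sqrt (s ^+ 2 + t ^+ 2) * u)%R.
Proof.
move=> s0 t0 mF F0; pose q := (Num.sqrt (s ^+ 2 + t ^+ 2))%R.
have q0 : (0 < q)%R by rewrite sqrtr_gt0 ltr_wpDl ?sqr_ge0 ?exprn_gt0.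
have q2 : (q ^+ 2 = s ^+ 2 + t ^+ 2)%R by rewrite sqr_sqrtr// addr_ge0 ?sqr_ge0.
under eq_integral do rewrite (std_gauss_shift _ t0 q0 mF F0).
pose h p := F (q * p.2)%R * (normal_ratio (s * p.1) t q (q * p.2))%:E.
have mh : measurable_fun [set: R * R] h.
  apply: emeasurable_funM.
    by apply: (measurableT_comp mF); exact: measurable_funM.
  by apply/measurable_EFinP/measurable_normal_ratio; exact: measurable_funM.
rewrite (@fubini_tonelli _ _ _ _ _ g g h mh); last first.
  by move=> p; rewrite mule_ge0// lee_fin ltW// normal_ratio_gt0.
apply: eq_integral => z _; rewrite /h/=.
have tq : (0 < t / q)%R by rewrite divr_gt0.
(* Completing the square in [x] turns the ratio into the density, relative to the standard normal
   law, of N(s z / q, (t / q)^2), the law of [x] given [s x + t y = q z]. *)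
under eq_integral => x _.
  rewrite (_ : normal_ratio _ _ _ _ = normal_ratio (s * z / q) (t / q) 1 (1 * x)); last first.
    rewrite /normal_ratio !mul1r invf_div; congr (_ * expR _)%R.
    have -> : ((q * z) ^+ 2 / (2 * q ^+ 2) - (q * z - s * x) ^+ 2 / (2 * t ^+ 2) =
      (z ^+ 2 * t ^+ 2 - (q ^+ 2 * z ^+ 2 - 2 * q * z * s * x + s ^+ 2 * x ^+ 2)) / (2 * t ^+ 2))%R.
      by field; rewrite !gt_eqF.
    have -> : (x ^+ 2 / (2 * 1 ^+ 2) - (x - s * z / q) ^+ 2 / (2 * (t / q) ^+ 2) =
      (x ^+ 2 * t ^+ 2 - (q ^+ 2 * x ^+ 2 - 2 * q * z * s * x + s ^+ 2 * z ^+ 2)) / (2 * t ^+ 2))%R.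
      by field; rewrite !gt_eqF.
    by rewrite q2; congr (_ / _)%R; ring.
  over.
rewrite ge0_integralZl//; last 2 first.
- by apply/measurable_EFinP/measurable_normal_ratio => //; exact: measurable_funM.
- by move=> x _; rewrite lee_fin ltW// normal_ratio_gt0.
by rewrite integral_normal_ratio// mule1.
Qed.

Lemma std_gauss_rotation (s t : R) (F : R -> \bar R) :
  measurable_fun [set: R] F -> (forall x, 0 <= F x) ->
  \int[g]_x \int[g]_y F (s * x + t * y)%R =
  \int[g]_u F (Num.sqrt (s ^+ 2 + t ^+ 2) * u)%R.
Proof.
move=> mF F0.
have cstg (c : \bar R) : 0 <= c -> \int[g]_x c = c.
  move=> c0; rewrite integral_cst//.
  by transitivity (c * 1); [congr (_ * _); exact: probability_setT|rewrite mule1].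
have [->|s0] := eqVneq s 0%R.
  under eq_integral do under eq_integral do rewrite mul0r add0r.
  rewrite cstg ?integral_ge0// expr0n/= add0r sqrtr_sqr.
  by rewrite std_gauss_scale_norm.
have [->|t0] := eqVneq t 0%R.
  under eq_integral do under eq_integral do rewrite mul0r addr0.
  under eq_integral do rewrite cstg//.
  by rewrite expr0n/= addr0 sqrtr_sqr std_gauss_scale_norm.
have nt0 : (0 < `|t|)%R by rewrite normr_gt0.
rewrite -(real_normK (num_real t)) -(std_gauss_rotation_gt0 s0 nt0 mF F0).
apply: eq_integral => x _; rewrite (@std_gauss_scale_norm t (fun y => F (s * x + y)%R))//.
by apply: (measurableT_comp mF); exact: measurable_funD.
Qed.

(** If [th <= s ^+ 2], the integrand is exactly the density of N(y, th) relative to N(0, s^2).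
    Otherwise the exponent is affine in [u], and the integrand is at most the density relative to
    N(0, s^2) of the normal law of variance [s ^+ 2] whose mean [s ^+ 2 * y / th] matches the linear
    term. *)
Lemma normal_certificate (s th y : R) : (0 < s)%R -> (0 < th)%R ->
  let m := (Num.max (s ^+ 2) th)%R in
  \int[g]_u (expR (ln (m / th) / 2 - (s * u - y) ^+ 2 / (2 * th)
     + (s * u) ^+ 2 / (2 * m)))%:E <= 1.
Proof.
move=> s0 th0; rewrite /=; case: (ltP (s ^+ 2)%R th) => h.
  rewrite divff ?gt_eqF// ln1 mul0r.
  under eq_integral do rewrite add0r.
  rewrite -(@integral_normal_ratio R (s ^+ 2 * y / th) s s)//.
  apply: ge0_le_integral => //.
  - apply/measurable_EFinP/(measurableT_comp (@measurable_expR R)).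
    apply: measurable_funD; last by apply: measurable_funM => //; apply: measurable_funX; exact: measurable_funM.
    apply: measurableT_comp => //; apply: measurable_funM => //; apply: measurable_funX.
    by apply: measurable_funB => //; exact: measurable_funM.
  - by apply/measurable_EFinP/measurable_normal_ratio => //; exact: measurable_funM.
  - move=> u _; rewrite lee_fin /normal_ratio divff ?gt_eqF// mul1r ler_expR.
    rewrite -subr_ge0.
    rewrite (_ : _ - _ = (y / th) ^+ 2 * (th - s ^+ 2) / 2)%R; last first.
      by field; rewrite !gt_eqF.
    by rewrite divr_ge0// mulr_ge0 ?sqr_ge0// subr_ge0 ltW.
rewrite -(@integral_normal_ratio R y (Num.sqrt th) s)//; last by rewrite sqrtr_gt0.
rewrite le_eqVlt; apply/orP; left; apply/eqP; apply: eq_integral => u _; congr EFin.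
rewrite /normal_ratio sqr_sqrtr; last exact: ltW.
rewrite -addrA [(- _ + _)%R]addrC expRD; congr (_ * _)%R.
have q0 : (0 < s / Num.sqrt th)%R by rewrite divr_gt0 ?sqrtr_gt0.
rewrite -[RHS]lnK ?posrE//; congr expR.
have -> : (s ^+ 2 / th = (s / Num.sqrt th) ^+ 2)%R.
  by rewrite exprMn exprVn sqr_sqrtr// ltW.
by rewrite lnXn// -[X in (X / _)%R = _]mulr_natr mulfK.
Qed.
End gaussian_rotation.

(** * Mean and variance of a normal variable *)

Section moments.
Context {d : measure_display} {T : measurableType d} {R : realType}.
Variables (P : probability T R) (Y : T -> R).
Local Open Scope ereal_scope.
Notation g := (@std_gauss R).

Lemma normal_law_functional (m s : R) : (0 < s)%R -> measurable_fun [set: T] Y ->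
  (forall A : set R, measurable A -> P (Y @^-1` A) = normal_prob m s A) ->
  forall F : R -> \bar R, measurable_fun [set: R] F -> (forall x, 0 <= F x) ->
  \int[P]_w F (Y w) = \int[g]_u F (m + s * u)%R.
Proof.
move=> s0 mY YE F mF F0; rewrite -ge0_integral_normal_probE//.
transitivity (\int[pushforward P (Y : T -> measurableTypeR R)]_x F x).
  by rewrite ge0_integral_pushforward.
by apply: eq_measure_integral => A mA _; exact: YE.
Qed.

Variables (m s : R).
Hypothesis s0 : (0 <= s)%R.
Hypothesis mY : measurable_fun [set: T] Y.
Hypothesis YE : forall F : R -> \bar R, measurable_fun [set: R] F -> (forall x, 0 <= F x) ->
  \int[P]_w F (Y w) = \int[g]_u F (m + s * u)%R.
Hypothesis Y2 : P.-integrable [set: T] (fun w => ((Y w) ^+ 2)%:E).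

(** The law of [Y] is symmetric about [m], so [Y] and [2 * m - Y] have the same mean. *)
Lemma normal_mean : \int[P]_w (Y w)%:E = 0 -> m = 0%R.
Proof.
move=> EY.
have sym (F : R -> \bar R) : measurable_fun [set: R] F -> (forall x, 0 <= F x) ->
    \int[P]_w F (2 * m - Y w)%R = \int[P]_w F (Y w).
  move=> mF F0; rewrite (YE (F := fun y => F (2 * m - y)%R))//; last first.
    by apply: (measurableT_comp mF); exact: measurable_funB.
  rewrite YE// -(@std_gauss_opp R (fun u => F (m + s * u)%R))//; last first.
    by apply: (measurableT_comp mF); apply: measurable_funD => //; exact: measurable_funM.
  by apply: eq_integral => u _; congr F; ring.
have iY : P.-integrable [set: T] (EFin \o Y).
  apply: (@le_integrable _ _ _ P _ _ _ (fun w => ((1 + Y w ^+ 2))%:E)) => //.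
  - exact/measurable_EFinP.
  - move=> w _ /=; rewrite lee_fin [leRHS]ger0_norm; last by rewrite addr_ge0// sqr_ge0.
    have := sqr_ge0 (`|Y w| - 1)%R; rewrite sqrrB real_normK ?num_real//.
    have := normr_ge0 (Y w); lra.
  - under eq_fun do rewrite EFinD.
    by apply: integrableD => //; exact: finite_measure_integrable_cst.
have : \int[P]_w (2 * m - Y w)%:E = \int[P]_w (Y w)%:E.
  rewrite integralE [RHS]integralE.
  congr (_ - _).
    under eq_integral do rewrite funeposE.
    under [RHS]eq_integral do rewrite funeposE.
    apply: (sym (fun y => maxe y%:E 0)) => [|x]; last by rewrite le_max lexx orbT.
    exact: measurable_maxe.
  under eq_integral do rewrite funenegE.
  under [RHS]eq_integral do rewrite funenegE.
  apply: (sym (fun y => maxe (- y%:E) 0)) => [|x]; last by rewrite le_max lexx orbT.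
  by apply: measurable_maxe => //; exact: measurableT_comp.
under eq_integral do rewrite EFinB.
rewrite integralB//; last exact: finite_measure_integrable_cst.
rewrite EY sube0 integral_cst// [X in _ * X](_ : _ = 1); last exact: probability_setT.
by rewrite mule1 => -[]; lra.
Qed.

(** A Gaussian integral of [expR (k * Y ^+ 2)] is available in closed form; its tangent
    [1 + k * Y ^+ 2], with [k] of either sign, pins the second moment from both sides. *)
Lemma normal_variance (v : R) : m = 0%R -> \int[P]_w ((Y w) ^+ 2)%:E = v%:E -> v = (s ^+ 2)%R.
Proof.
move=> m0 EY2.
have Pcst := integral_prob_cst P.
have [s00|sn0] := eqVneq s 0%R.
  move: EY2; rewrite (YE (F := fun y => (y ^+ 2)%:E)); last 2 first.
  - by apply/measurable_EFinP; exact: measurable_funX.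
  - by move=> x; rewrite lee_fin sqr_ge0.
  rewrite (eq_integral (cst 0)); last first.
    by move=> u _; rewrite /= m0 s00 mul0r addr0 expr0n.
  by rewrite integral0 s00 expr0n/= => -[].
have sp : (0 < s)%R by rewrite lt_neqAle eq_sym sn0.
have v0 : (0 <= v)%R.
  by rewrite -lee_fin -EY2 integral_ge0// => w _; rewrite lee_fin sqr_ge0.
(* E e^{kY^2} = c with k = (1 - 1/c^2) / (2 s^2), to be compared with 1 + k E Y^2. *)
have tangent (c : R) : (0 < c)%R -> (v / s ^+ 2 * ((c ^+ 2 - 1) / (2 * c ^+ 2)) <= c - 1)%R.
  move=> c0; pose k := ((1 - (c ^+ 2)^-1) / (2 * s ^+ 2))%R.
  have H : \int[P]_w (expR (k * (Y w) ^+ 2))%:E = c%:E.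
    rewrite (YE (F := fun y => (expR (k * y ^+ 2))%:E)); last 2 first.
    - apply/measurable_EFinP/(measurableT_comp (@measurable_expR R)).
      by apply: measurable_funM => //; exact: measurable_funX.
    - by move=> x; rewrite lee_fin expR_ge0.
    rewrite -[RHS]mule1 -(@integral_normal_ratio R 0 c 1)//.
    rewrite -ge0_integralZl//; last 3 first.
    - by apply/measurable_EFinP/measurable_normal_ratio => //; exact: measurable_funM.
    - by move=> x _; rewrite lee_fin ltW// normal_ratio_gt0.
    - by rewrite lee_fin ltW.
    apply: eq_integral => u _; rewrite -EFinM /normal_ratio; congr EFin.
    rewrite [RHS]mulrA [(c * (1 / c))%R]mulrC divfK ?gt_eqF// !mul1r m0 add0r subr0; congr expR.
    by rewrite /k; field; rewrite !gt_eqF.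
  have : \int[P]_w (1 + k * (Y w) ^+ 2)%:E <= c%:E.
    rewrite -H; apply: le_integral.
    - by [].
    - under eq_fun do rewrite EFinD EFinM.
      apply: integrableD => //; first exact: finite_measure_integrable_cst.
      exact: integrableZl.
    - apply/integrableP; split.
        apply/measurable_EFinP/(measurableT_comp (@measurable_expR R)).
        by apply: measurable_funM => //; exact: measurable_funX.
      under eq_integral do rewrite gee0_abs ?lee_fin ?expR_ge0//.
      by rewrite H ltry.
    - by move=> w _; rewrite lee_fin expR_ge1Dx.
  under eq_integral do rewrite EFinD EFinM.
  rewrite integralD//; last 2 first.
  - exact: finite_measure_integrable_cst.
  - exact: integrableZl.
  rewrite Pcst integralZl// EY2 -EFinM -EFinD lee_fin.
  rewrite (_ : k * v = v / s ^+ 2 * ((c ^+ 2 - 1) / (2 * c ^+ 2)))%R; first lra.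
  by rewrite /k; field; rewrite !gt_eqF.
have s20 : (s ^+ 2 != 0)%R by rewrite expf_neq0.
suff : (v / s ^+ 2 = 1)%R by move=> /(congr1 (fun t => t * s ^+ 2)%R); rewrite divfK// mul1r.
have : (0 <= v / s ^+ 2)%R by rewrite divr_ge0// sqr_ge0.
move: (v / s ^+ 2)%R tangent => r tangent r0.
(* With [c = 1 + e], cancelling [e] gives opposite inequalities for the two signs of [e], and both
   become equality at [r = 1] when [e] tends to 0. A quarter of [r - 1], capped at 1, is small
   enough for a contradiction. *)
have {}tangent e : (-1 < e)%R -> (e * (r * (2 + e)) <= e * (2 * (1 + e) ^+ 2))%R.
  move=> e1; have c0 : (0 < 1 + e)%R by lra.
  have := tangent _ c0.
  rewrite (_ : r * _ = (e * (r * (2 + e))) / (2 * (1 + e) ^+ 2))%R; last by field; lra.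
  rewrite ler_pdivrMr ?mulr_gt0 ?exprn_gt0//.
  by rewrite (_ : 1 + e - 1 = e)%R; last ring.
have [rlt|rgt|//] := ltrgtP r 1%R.
  have e1 : (-1 < (r - 1) / 4)%R by lra.
  have e0 : ((r - 1) / 4 < 0)%R by lra.
  have := tangent _ e1; rewrite ler_nM2l//; nra.
have e1 : (-1 < Num.min 1 ((r - 1) / 4))%R by rewrite lt_min; apply/andP; split; lra.
have e0 : (0 < Num.min 1 ((r - 1) / 4))%R by rewrite lt_min; apply/andP; split; lra.
have := tangent _ e1; rewrite ler_pM2l//.
case: (ltP 1%R ((r-1)/4)%R) => ?; nra.
Qed.
End moments.

(** * Standard normal vectors *)

Section gaussian_tuple.
Context {R : realType}.
Local Open Scope ereal_scope.
Notation g := (@std_gauss R).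

Section cons.
Variable n : nat.
Definition tuple_cons (p : R * n.-tuple R) : n.+1.-tuple R := [tuple of p.1 :: p.2].
Lemma measurable_tuple_cons : measurable_fun [set: R * n.-tuple R] tuple_cons.
Proof. exact: measurable_cons. Qed.
HB.instance Definition _ :=
  @isMeasurableFun.Build _ _ _ _ tuple_cons measurable_tuple_cons.
End cons.

(** Built by recursion through [tuple_cons], so that Tonelli peels off one coordinate at a time in
    inductions. *)
Fixpoint std_gauss_tuple (n : nat) : probability (n.-tuple R) R :=
  match n with
  | 0 => \d_ ([tuple] : 0.-tuple R)
  | n'.+1 => distribution (g \x std_gauss_tuple n' : probability _ R) (@tuple_cons n')
  end.
Notation G := std_gauss_tuple.

Lemma ge0_integral_std_gauss_tupleS n (F : n.+1.-tuple R -> \bar R) :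
  measurable_fun setT F -> (forall x, 0 <= F x) ->
  \int[G n.+1]_u F u = \int[g]_x \int[G n]_t F (tuple_cons (x, t)).
Proof.
move=> mF F0; have mFc := measurableT_comp mF (@measurable_tuple_cons n).
transitivity (\int[g \x G n]_p (F \o @tuple_cons n) p).
  by rewrite ge0_integral_distribution.
exact: (fubini_tonelli1 _ mFc (fun=> F0 _)).
Qed.

Lemma integral_std_gauss_tuple0 (F : 0.-tuple R -> \bar R) :
  measurable_fun setT F -> (forall x, 0 <= F x) -> \int[G 0]_u F u = F [tuple].
Proof. by move=> mF F0; rewrite integral_dirac// diracT mul1e. Qed.

Definition vaff n (a b : 'I_n -> R) (u : n.-tuple R) : n.-tuple R :=
  [tuple (a i + b i * tnth u i)%R | i < n].

Lemma measurable_vaff d (T : measurableType d) n (a : T -> 'I_n -> R) (b : 'I_n -> R)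
    (u : T -> n.-tuple R) :
  (forall i, measurable_fun [set: T] (fun w => a w i)) -> measurable_fun [set: T] u ->
  measurable_fun [set: T] (fun w => vaff (a w) b (u w)).
Proof.
move=> ma mu; apply/measurable_fun_tnthP => i.
rewrite (_ : _ \o _ = fun w => a w i + b i * tnth (u w) i)%R; last first.
  by apply/funext => w /=; rewrite tnth_mktuple.
apply: measurable_funD => //; apply: measurable_funM => //.
exact: (measurableT_comp (measurable_tnth i) mu).
Qed.

Lemma vaff_cons n (a b : 'I_n.+1 -> R) x t :
  vaff a b (tuple_cons (x, t)) =
  tuple_cons ((a ord0 + b ord0 * x)%R, vaff (a \o lift ord0) (b \o lift ord0) t).
Proof.
apply: eq_from_tnth => i; rewrite tnth_mktuple.
case: (unliftP ord0 i) => [j ->|->].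
  by rewrite /tuple_cons !tnthS tnth_mktuple.
by rewrite /tuple_cons !tnth0.
Qed.

(** Density of the product of the laws N(a_i, b_i^2) relative to the product of the laws N(0,
    s_i^2). *)
Definition vratio n (a b s : 'I_n -> R) (z : n.-tuple R) : R :=
  (\prod_(i < n) normal_ratio (a i) (b i) (s i) (tnth z i))%R.

Lemma measurable_vratio d (T : measurableType d) n (a : T -> 'I_n -> R) (b s : 'I_n -> R)
    (z : T -> n.-tuple R) :
  (forall i, measurable_fun [set: T] (fun w => a w i)) -> measurable_fun [set: T] z ->
  measurable_fun [set: T] (fun w => vratio (a w) b s (z w)).
Proof.
move=> ma mz; apply: measurable_prod => i _; apply: measurable_normal_ratio => //.
exact: (measurableT_comp (measurable_tnth i) mz).
Qed.

Lemma vratio_gt0 n (a b s : 'I_n -> R) z : (forall i, (0 < b i)%R) ->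
  (forall i, (0 < s i)%R) -> (0 < vratio a b s z)%R.
Proof. by move=> b0 s0; apply: prodr_gt0 => i _; exact: normal_ratio_gt0. Qed.

(** The induction hypothesis changes the reference law of the tail for a fixed head, and
    [std_gauss_shift] that of the head; the two ratios multiply. *)
Lemma std_gauss_tuple_shift n (a b s : 'I_n -> R) (F : n.-tuple R -> \bar R) :
  (forall i, (0 < b i)%R) -> (forall i, (0 < s i)%R) ->
  measurable_fun setT F -> (forall x, 0 <= F x) ->
  \int[G n]_u F (vaff a b u) =
  \int[G n]_u (F (vaff (fun=> 0%R) s u) * (vratio a b s (vaff (fun=> 0%R) s u))%:E).
Proof.
have mv m (c e : 'I_m -> R) : measurable_fun setT (vaff c e).
  by apply: (measurable_vaff (a := fun=> c) e).
have mr m (c e f : 'I_m -> R) : measurable_fun setT (fun u => (vratio c e f (vaff (fun=> 0%R) f u))%:E).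
  by apply/measurable_EFinP; apply: (measurable_vratio (a := fun=> c) (z := vaff (fun=> 0%R) f) e f);
    [move=> i; exact: measurable_cst|exact: mv].
elim: n => [|n IH] in a b s F * => b0 s0 mF F0.
  rewrite !integral_std_gauss_tuple0//.
  - by rewrite /vratio big_ord0 mule1; congr F; apply: eq_from_tnth => -[].
  - by apply: emeasurable_funM; [exact: (measurableT_comp mF (mv _ _ _))|exact: mr].
  - by move=> x; rewrite mule_ge0// lee_fin ltW// vratio_gt0.
  - exact: (measurableT_comp mF (mv _ _ _)).
rewrite !ge0_integral_std_gauss_tupleS//; last 3 first.
- by apply: emeasurable_funM; [exact: (measurableT_comp mF (mv _ _ _))|exact: mr].
- by move=> x; rewrite mule_ge0// lee_fin ltW// vratio_gt0.
- exact: (measurableT_comp mF (mv _ _ _)).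
pose a' := a \o lift ord0; pose b' := b \o lift ord0; pose s' := s \o lift ord0.
pose h y t := F (tuple_cons (y, vaff (fun=> 0%R) s' t)) *
  (vratio a' b' s' (vaff (fun=> 0%R) s' t))%:E.
have h0 y t : 0 <= h y t.
  by rewrite mule_ge0// lee_fin ltW// vratio_gt0 => //= i; [exact: b0|exact: s0].
have mh : measurable_fun [set: R * n.-tuple R] (fun p => h p.1 p.2).
  apply: emeasurable_funM; last exact: (measurableT_comp (mr _ _ _ _) measurable_snd).
  apply: (measurableT_comp mF); apply: (measurableT_comp (@measurable_tuple_cons n)).
  by apply: measurable_fun_pair => //; exact: (measurableT_comp (mv _ _ _) measurable_snd).
transitivity (\int[g]_x \int[G n]_t h (a ord0 + b ord0 * x)%R t).
  apply: eq_integral => x _.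
  under eq_integral do rewrite vaff_cons.
  apply: (IH a' b' s' (fun t => F (tuple_cons ((a ord0 + b ord0 * x)%R, t)))) => //.
  - by move=> i; exact: b0.
  - by move=> i; exact: s0.
  - apply: (measurableT_comp mF); apply: (measurableT_comp (@measurable_tuple_cons n)).
    exact: pair1_measurable.
rewrite (@std_gauss_shift R (a ord0) (b ord0) (s ord0) (fun y => \int[G n]_t h y t))//; last 2 first.
- by apply: (measurable_fun_fubini_tonelli_F (fun p => h p.1 p.2)) => // p; exact: h0.
- by move=> y; apply: integral_ge0 => t _; exact: h0.
apply: eq_integral => x _.
have mht : measurable_fun setT (h (s ord0 * x)%R).
  exact: (measurableT_comp mh (pair1_measurable (s ord0 * x)%R)).
rewrite -ge0_integralZr//; last by rewrite lee_fin ltW// normal_ratio_gt0.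
apply: eq_integral => t _.
rewrite vaff_cons/= add0r /h -muleA -EFinM; congr (_ * EFin _).
rewrite /vratio big_ord_recl/= mulrC; congr (_ * _)%R.
by apply: eq_bigr => i _; rewrite /tuple_cons tnthS.
Qed.

(** By induction the tail of the sum acts as one normal variable, which [std_gauss_rotation] merges
    with the head. *)
Lemma std_gauss_tuple_rotation n (c : 'I_n -> R) (F : R -> \bar R) :
  measurable_fun setT F -> (forall x, 0 <= F x) ->
  \int[G n]_u F (\sum_(i < n) c i * tnth u i)%R =
  \int[g]_u F (Num.sqrt (\sum_(i < n) c i ^+ 2) * u)%R.
Proof.
have ms m (c' : 'I_m -> R) : measurable_fun setT (fun u : m.-tuple R => \sum_(i < m) c' i * tnth u i)%R.
  apply: measurable_sum => i; apply: measurable_funM => //; exact: measurable_tnth.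
elim: n => [|n IH] in c F * => mF F0.
  rewrite integral_std_gauss_tuple0//; last exact: (measurableT_comp mF (ms _ _)).
  rewrite !big_ord0 sqrtr0; under eq_integral do rewrite mul0r.
  rewrite integral_cst//.
  by transitivity (F 0%R * 1); [rewrite mule1|congr (_ * _); apply/esym; exact: probability_setT].
rewrite ge0_integral_std_gauss_tupleS//; last exact: (measurableT_comp mF (ms _ _)).
pose c' := c \o lift ord0.
transitivity (\int[g]_x \int[g]_y F (c ord0 * x + Num.sqrt (\sum_(i < n) c' i ^+ 2) * y)%R).
  apply: eq_integral => x _; rewrite -(IH c' (fun y => F (c ord0 * x + y)%R))//; last first.
    by apply: (measurableT_comp mF); exact: measurable_funD.
  apply: eq_integral => t _; congr F; rewrite big_ord_recl/= /tuple_cons tnth0; congr (_ + _)%R.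
  by apply: eq_bigr => i _; rewrite tnthS.
rewrite std_gauss_rotation//; apply: eq_integral => u _; congr (F (Num.sqrt _ * u)%R).
by rewrite sqr_sqrtr ?sumr_ge0// ?[in RHS]big_ord_recl// => i _; exact: sqr_ge0.
Qed.

Lemma std_gauss_tuple_prod_le1 n (f : 'I_n -> R -> R) :
  (forall i, measurable_fun setT (f i)) -> (forall i x, (0 <= f i x)%R) ->
  (forall i, \int[g]_x (f i x)%:E <= 1) ->
  \int[G n]_u (\prod_(i < n) f i (tnth u i))%:E <= 1.
Proof.
have mp m (f' : 'I_m -> R -> R) : (forall i, measurable_fun setT (f' i)) ->
    measurable_fun setT (fun u : m.-tuple R => (\prod_(i < m) f' i (tnth u i))%:E).
  move=> mf; apply/measurable_EFinP/measurable_prod => i _.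
  exact: (measurableT_comp (mf i) (measurable_tnth i)).
elim: n => [|n IH] in f * => mf f0 f1.
  by rewrite integral_std_gauss_tuple0; [rewrite big_ord0|exact: mp|move=> u; rewrite lee_fin prodr_ge0].
rewrite ge0_integral_std_gauss_tupleS; [|exact: mp|by move=> u; rewrite lee_fin prodr_ge0].
apply: le_trans (f1 ord0); apply: ge0_le_integral => //.
- by move=> x _; apply: integral_ge0 => t _; rewrite lee_fin prodr_ge0.
- apply: (measurable_fun_fubini_tonelli_F (fun p => (\prod_i f i (tnth (tuple_cons p) i))%:E)).
    exact: (measurableT_comp (mp _ _ mf) (@measurable_tuple_cons n)).
  by move=> p; rewrite lee_fin prodr_ge0.
- exact/measurable_EFinP.
- move=> x _; under eq_integral => t _.
    rewrite big_ord_recl /tuple_cons tnth0 EFinM.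
    under eq_bigr do rewrite tnthS.
    over.
  rewrite /= ge0_integralZl//; last 3 first.
  + by apply: (mp n (fun i => f (lift ord0 i))).
  + by move=> t _; rewrite lee_fin prodr_ge0.
  + by rewrite lee_fin.
  have IH1 := IH (fun i => f (lift ord0 i)) (fun i => mf _) (fun i => f0 _) (fun i => f1 _).
  by rewrite -[leRHS]mule1; apply: lee_wpmul2l; rewrite ?lee_fin.
Qed.
End gaussian_tuple.

(** * The Cramer-Wold theorem *)

Section cramer_wold.
Context {R : realType} {n : nat}.
Variables mu nu : probability (n.-tuple R) R.
Hypothesis projections_eq : forall (a : n.-tuple R) (F : R -> \bar R),
  measurable_fun [set: R] F -> (forall x, (0 <= F x)%E) ->
  (\int[mu]_x F (dotv a x) = \int[nu]_x F (dotv a x))%E.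

Let bounded (h : n.-tuple R -> R) := exists K : R, forall x, `|h x| <= K.

Lemma integrable_bounded (P : probability (n.-tuple R) R) (h : n.-tuple R -> R) :
  measurable_fun [set: n.-tuple R] h -> bounded h ->
  P.-integrable [set: n.-tuple R] (EFin \o h).
Proof.
move=> mh [K hK].
apply: (@le_integrable _ _ _ P _ _ _ (EFin \o cst K)) => //.
- exact/measurable_EFinP.
- by move=> x _ /=; rewrite lee_fin (le_trans (hK x))// ler_norm.
- exact: finite_measure_integrable_cst.
Qed.

Let wave (a : n.-tuple R) (b : R) (x : n.-tuple R) : R := cos (dotv a x + b).

Lemma measurable_dotv (a : n.-tuple R) : measurable_fun [set: n.-tuple R] (dotv a).
Proof.
by apply: measurable_sum => i; apply: measurable_funM => //; exact: measurable_tnth.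
Qed.

Lemma measurable_cos : measurable_fun [set: R] (@cos R).
Proof. apply: continuous_measurable_fun; exact: continuous_cos. Qed.

Let measurable_wave a b : measurable_fun [set: n.-tuple R] (wave a b).
Proof.
apply: (measurableT_comp measurable_cos); apply: measurable_funD => //.
exact: measurable_dotv.
Qed.

Let bounded_wave a b : bounded (wave a b).
Proof. by exists 1 => x; rewrite ler_norml cos_geN1 cos_le1. Qed.

Let boundedM h k : bounded h -> bounded k -> bounded (fun x => h x * k x).
Proof.
move=> [K hK] [L kL]; exists (K * L) => x; rewrite normrM ler_pM//.
Qed.

Let boundedD h k : bounded h -> bounded k -> bounded (fun x => h x + k x).
Proof.
by move=> [K hK] [L kL]; exists (K + L) => x; rewrite (le_trans (ler_normD _ _))// lerD.
Qed.

(* Multipliers of the tame functions form an algebra that contains the trigonometric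
   polynomials and is closed under bounded limits; hence the sets whose indicator is a
   multiplier form a sigma-algebra, which is shown to contain the half-spaces. *)
Definition tame (h : n.-tuple R -> R) := [/\ measurable_fun [set: n.-tuple R] h, bounded h &
  forall a b, \int[mu]_x (h x * wave a b x) = \int[nu]_x (h x * wave a b x)].

Definition multiplier (m : n.-tuple R -> R) := [/\ measurable_fun [set: n.-tuple R] m,
  bounded m & forall h, tame h -> tame (fun x => h x * m x)].

(** Projections are compared on non-negative functions only, so the cosine is raised by 1 and the
    constant removed afterwards. *)
Lemma tame1 : tame (cst 1).
Proof.
split => //; first by exists 1 => x; rewrite normr1.
move=> a b.
have E (P : probability (n.-tuple R) R) :
    \int[P]_x (cst 1 x * wave a b x) = \int[P]_x (1 + wave a b x) - 1.
  rewrite RintegralD//; last exact: integrable_bounded.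
  - rewrite Rintegral_cst// [fine _](_ : _ = 1) ?mulr1; last first.
      by transitivity (fine (1 : \bar R)); first by congr fine; exact: probability_setT.
    by rewrite [RHS]addrC addKr; apply: eq_Rintegral => x _; rewrite mul1r.
  - exact: finite_measure_integrable_cst.
rewrite !E; congr (_ - 1); congr fine.
apply: (projections_eq a (F := fun y => (1 + cos (y + b))%:E)).
  apply/measurable_EFinP/measurable_funD => //.
  by apply: (measurableT_comp measurable_cos); exact: measurable_funD.
by move=> x; rewrite lee_fin -lerBlDl sub0r cos_geN1.
Qed.

Lemma tameD h k : tame h -> tame k -> tame (fun x => h x + k x).
Proof.
move=> [mh bh hE] [mk bk kE]; split; [exact: measurable_funD|exact: boundedD|move=> a b].
have E (P : probability (n.-tuple R) R) : \int[P]_x ((h x + k x) * wave a b x) =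
    \int[P]_x (h x * wave a b x) + \int[P]_x (k x * wave a b x).
  rewrite -RintegralD//; first by apply: eq_Rintegral => x _; rewrite mulrDl.
  - by apply: integrable_bounded; [exact: measurable_funM|exact: boundedM].
  - by apply: integrable_bounded; [exact: measurable_funM|exact: boundedM].
by rewrite !E hE kE.
Qed.

Lemma tameZ h c : tame h -> tame (fun x => c * h x).
Proof.
move=> [mh bh hE]; split; [exact: measurable_funM| |move=> a b].
  by apply: boundedM => //; exists `|c|.
have E (P : probability (n.-tuple R) R) : \int[P]_x ((c * h x) * wave a b x) =
    c * \int[P]_x (h x * wave a b x).
  rewrite -RintegralZl//; first by apply: eq_Rintegral => x _; rewrite mulrA.
  by apply: integrable_bounded; [exact: measurable_funM|exact: boundedM].
by rewrite !E hE.
Qed.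

Lemma multiplierD m k : multiplier m -> multiplier k -> multiplier (fun x => m x + k x).
Proof.
move=> [mm bm mT] [mk bk kT]; split; [exact: measurable_funD|exact: boundedD|move=> h th].
rewrite (_ : (fun x => _) = (fun x => h x * m x + h x * k x)); last first.
  by apply/funext => x; rewrite mulrDr.
by apply: tameD; [exact: mT|exact: kT].
Qed.

Lemma multiplierM m k : multiplier m -> multiplier k -> multiplier (fun x => m x * k x).
Proof.
move=> [mm bm mT] [mk bk kT]; split; [exact: measurable_funM|exact: boundedM|move=> h th].
rewrite (_ : (fun x => _) = (fun x => (h x * m x) * k x)); last first.
  by apply/funext => x; rewrite mulrA.
by apply: kT; exact: mT.
Qed.

Lemma multiplier_cst c : multiplier (fun=> c).
Proof.
split => //; first by exists `|c|.
move=> h th; rewrite (_ : (fun x => _) = (fun x => c * h x)); first exact: tameZ.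
by apply/funext => x; rewrite mulrC.
Qed.

(** The product of two cosines is half the sum of the cosines of sum and difference, so a product of
    waves is again a combination of waves. *)
Lemma multiplier_wave a b : multiplier (wave a b).
Proof.
split => // h [mh bh hE]; split; [exact: measurable_funM|exact: boundedM|move=> a' b'].
pose ap := [tuple tnth a i + tnth a' i | i < n].
pose am := [tuple tnth a i - tnth a' i | i < n].
have dp x : dotv ap x = dotv a x + dotv a' x.
  by rewrite /dotv -big_split; apply: eq_bigr => i _; rewrite tnth_mktuple mulrDl.
have dm x : dotv am x = dotv a x - dotv a' x.
  by rewrite /dotv -sumrB; apply: eq_bigr => i _; rewrite tnth_mktuple mulrBl.
have E (P : probability (n.-tuple R) R) : \int[P]_x (h x * wave a b x * wave a' b' x) =
    2^-1 * (\int[P]_x (h x * wave ap (b + b') x) + \int[P]_x (h x * wave am (b - b') x)).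
  have ip c e : P.-integrable [set: n.-tuple R] (EFin \o (fun x => h x * wave c e x)).
    by apply: integrable_bounded; [exact: measurable_funM|exact: boundedM].
  rewrite -RintegralD// -RintegralZl//; last first.
    by apply: integrable_bounded; [apply: measurable_funD; exact: measurable_funM
      |apply: boundedD; exact: boundedM].
  apply: eq_Rintegral => x _; rewrite -mulrDr mulrCA -mulrA; congr (_ * _).
  rewrite /wave dp dm.
  rewrite (_ : _ + _ + (b + b') = (dotv a x + b) + (dotv a' x + b')); last by ring.
  rewrite (_ : _ - _ + (b - b') = (dotv a x + b) - (dotv a' x + b')); last by ring.
  by move: (dotv a x + b) (dotv a' x + b') => A B; rewrite cosD cosB; field.
by rewrite !E !hE.
Qed.

Lemma multiplier_lim (m_ : nat -> n.-tuple R -> R) m K :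
  (forall k, multiplier (m_ k)) -> (forall k x, `|m_ k x| <= K) ->
  (forall x, m_ ^~ x @ \oo --> m x) -> multiplier m.
Proof.
move=> mult mK lim.
have mm : measurable_fun [set: n.-tuple R] m.
  by apply: (measurable_fun_cvg (h := m_)) => // k; have [] := mult k.
have bm : bounded m.
  exists K => x; rewrite -(cvg_lim _ (cvg_norm (lim x)))//.
  apply: limr_le; first by apply: cvgP; exact: cvg_norm (lim x).
  by apply: nearW => k; exact: mK.
split => // h [mh bh hE]; split; [exact: measurable_funM|exact: boundedM|move=> a b].
have C (P : probability (n.-tuple R) R) :
    \int[P]_x (h x * m_ k x * wave a b x) @[k --> \oo] --> \int[P]_x (h x * m x * wave a b x).
  have [L hL] := bh.
  apply: fine_cvg; rewrite fineK; last first.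
    apply: integrable_fin_num => //; apply: integrable_bounded.
      by apply: measurable_funM => //; exact: measurable_funM.
    by do 2?apply: boundedM.
  have [] := @dominated_convergence _ _ R P [set: n.-tuple R] measurableT
    (fun k x => (h x * m_ k x * wave a b x)%:E) (fun x => (h x * m x * wave a b x)%:E)
    (fun=> (L * K)%:E) => //.
  - move=> k; apply/measurable_EFinP; apply: measurable_funM => //; apply: measurable_funM => //.
    by have [] := mult k.
  - apply/measurable_EFinP; apply: measurable_funM => //; exact: measurable_funM.
  - apply: nearW => x _; apply: cvg_EFin; first exact: nearW.
    apply: cvgM; last exact: cvg_cst.
    by apply: cvgM; [exact: cvg_cst|exact: lim].
  - exact: finite_measure_integrable_cst.
  - apply: nearW => x k _; rewrite lee_fin !normrM -[leRHS]mulr1.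
    rewrite ler_pM ?mulr_ge0//; first by rewrite ler_pM.
    by rewrite ler_norml cos_geN1 cos_le1.
have e : (fun k => \int[mu]_x (h x * m_ k x * wave a b x)) =
    (fun k => \int[nu]_x (h x * m_ k x * wave a b x)).
  by apply/funext => k; have [_ _ /(_ h) []] := mult k.
by rewrite -(cvg_lim (@Rhausdorff R) (C mu)) -(cvg_lim (@Rhausdorff R) (C nu)) e.
Qed.

(* (3 t - t^3) / 2: on [-1, 1] its iterates converge to the sign function. *)
Let smooth_sg (t : R) : R := 3 / 2 * t + (- 2^-1) * (t * (t * t)).

Let smooth_sg01 (t : R) : 0 <= t <= 1 -> t <= smooth_sg t <= 1.
Proof.
move=> /andP[t0 t1]; apply/andP; split; rewrite -subr_ge0 /smooth_sg.
  rewrite (_ : _ - _ = t * ((1 - t) * (1 + t)) / 2); last by field.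
  by rewrite divr_ge0// !mulr_ge0//; lra.
rewrite (_ : _ - _ = (1 - t) * ((1 - t) * (2 + t)) / 2); last by field.
by rewrite divr_ge0// !mulr_ge0//; lra.
Qed.

Let iter_smooth_sg_ge (s : R) k : 0 <= s <= 1 -> s <= iter k smooth_sg s <= 1.
Proof.
move=> s01; elim: k => [|k /andP[IH1 IH2]]; first by have /andP[_ ->] := s01; rewrite lexx.
have /andP[h1 h2] : iter k smooth_sg s <= smooth_sg (iter k smooth_sg s) <= 1.
  by apply: smooth_sg01; rewrite IH2 andbT (le_trans _ IH1)//; case/andP: s01.
by rewrite iterS (le_trans IH1).
Qed.

Let iter_smooth_sgN (s : R) k : iter k smooth_sg (- s) = - iter k smooth_sg s.
Proof. by elim: k => //= k ->; rewrite /smooth_sg; ring. Qed.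

(** The iterates stay above [s], so each step multiplies the distance to 1 by at most
    [1 - s / 2]. *)
Let iter_smooth_sg_cvg1 (s : R) : 0 < s <= 1 -> iter k smooth_sg s @[k --> \oo] --> (1 : R).
Proof.
move=> /andP[s0 s1]; have s01 : 0 <= s <= 1 by rewrite ltW.
have lb k : 1 - iter k smooth_sg s <= (1 - s / 2) ^+ k.
  elim: k => [|k IH]; first by rewrite expr0 /=; lra.
  have /andP[h1 h2] := iter_smooth_sg_ge k s01.
  rewrite iterS exprSr; move: (iter k smooth_sg s) IH h1 h2 => t IH h1 h2.
  apply: (@le_trans _ _ ((1 - t) * (1 - s / 2))); last by rewrite ler_wpM2r//; lra.
  rewrite -subr_ge0 (_ : _ - _ = (1 - t) * ((t - s) + t * t) / 2); last by rewrite /smooth_sg; field.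
  have ts : 0 <= t - s by lra.
  have tt : 0 <= t * t by rewrite mulr_ge0//; lra.
  by rewrite divr_ge0// mulr_ge0//; lra.
apply: (@squeeze_cvgr _ _ _ _ (fun k => 1 - (1 - s / 2) ^+ k) (cst 1)).
- apply: nearW => k; have /andP[_ ->] := iter_smooth_sg_ge k s01.
  by rewrite andbT lerBlDr -lerBlDl.
- rewrite -[X in _ --> X]subr0; apply: cvgB; first exact: cvg_cst.
  by apply: cvg_expr; rewrite ger0_norm; lra.
- exact: cvg_cst.
Qed.

Let iter_smooth_sg_cvg (s : R) : `|s| <= 1 -> iter k smooth_sg s @[k --> \oo] --> Num.sg s.
Proof.
move=> s1; have [s0|s0|->] := ltrgtP s 0.
- rewrite ltr0_sg//.
  rewrite (_ : (fun k => _) = (fun k => - iter k smooth_sg (- s))); last first.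
    by apply/funext => k; rewrite iter_smooth_sgN opprK.
  apply: cvgN; apply: iter_smooth_sg_cvg1; rewrite oppr_gt0 s0/=.
  by rewrite (le_trans (ler_norm _))// normrN.
- by rewrite gtr0_sg//; apply: iter_smooth_sg_cvg1; rewrite s0 (le_trans (ler_norm _) s1).
- rewrite sgr0 (_ : (fun k => _) = cst 0); first exact: cvg_cst.
  by apply/funext => k; elim: k => //= k ->; rewrite /smooth_sg; ring.
Qed.

Lemma multiplier_sg m : multiplier m -> (forall x, `|m x| <= 1) ->
  multiplier (fun x => Num.sg (m x)).
Proof.
move=> mult m1.
apply: (@multiplier_lim (fun k x => iter k smooth_sg (m x)) _ 1).
- elim=> [//|k IH]; rewrite /= /smooth_sg.
  apply: multiplierD; first by apply: multiplierM => //; exact: multiplier_cst.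
  apply: multiplierM; first exact: multiplier_cst.
  by apply: multiplierM => //; exact: multiplierM.
- move=> k x; have [m0|m0] := leP 0 (m x).
    have /(iter_smooth_sg_ge k)/andP[h1 h2] : 0 <= m x <= 1.
      by rewrite m0 (le_trans (ler_norm _) (m1 x)).
    by rewrite ger0_norm// (le_trans m0).
  have h0 : 0 <= - m x by rewrite oppr_ge0 ltW.
  have /(iter_smooth_sg_ge k)/andP[h1 h2] : 0 <= - m x <= 1.
    by rewrite h0 (le_trans (ler_norm _))// normrN.
  by rewrite -normrN -iter_smooth_sgN ger0_norm// (le_trans h0).
- by move=> x; exact: iter_smooth_sg_cvg.
Qed.

Let mset (A : set (n.-tuple R)) := multiplier (\1_A).

Let mset_pos m : multiplier m -> (forall x, `|m x| <= 1) -> mset [set x | 0 < m x].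
Proof.
move=> mult m1; have sgm := multiplier_sg mult m1; rewrite /mset.
rewrite (_ : \1_ _ = (fun x => 2^-1 * (Num.sg (m x) + Num.sg (m x) * Num.sg (m x)))).
  apply: multiplierM; first exact: multiplier_cst.
  by apply: multiplierD => //; exact: multiplierM.
apply/funext => x; rewrite indicE; have [h|h|h] := ltrgtP 0 (m x).
- by rewrite mem_set// gtr0_sg//=; field.
- by rewrite memNset ?ltr0_sg//=; [field|move=> /(lt_trans h); rewrite ltxx].
- by rewrite memNset -?h ?sgr0//=; [field|rewrite /= -h ltxx].
Qed.

Let msetC A : mset A -> mset (~` A).
Proof.
move=> mA; rewrite /mset (_ : \1_ _ = (fun x => 1 + (-1) * \1_A x)).
  by apply: multiplierD; [exact: multiplier_cst|apply: multiplierM => //; exact: multiplier_cst].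
by apply/funext => x; rewrite !indicE in_setC; case: (x \in A) => /=; ring.
Qed.

(** The indicator of a union is the limit of one minus the finite products of complementary
    indicators, all with values in [0, 1]. *)
Let mset_bigcup (F : (set (n.-tuple R))^nat) : (forall k, mset (F k)) -> mset (\bigcup_k F k).
Proof.
move=> mF; apply: (@multiplier_lim (fun N x => 1 + (-1) * \prod_(k < N) (1 + (-1) * \1_(F k) x)) _ 1).
- move=> N; apply: multiplierD; first exact: multiplier_cst.
  apply: multiplierM; first exact: multiplier_cst.
  elim: N => [|N IH].
    by rewrite (_ : (fun x => _) = (fun=> 1)); [exact: multiplier_cst|apply/funext => x; rewrite big_ord0].
  rewrite (_ : (fun x => _) = (fun x => (\prod_(k < N) (1 + (-1) * \1_(F k) x)) * (1 + (-1) * \1_(F N) x))).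
    apply: multiplierM => //; apply: multiplierD; first exact: multiplier_cst.
    by apply: multiplierM; [exact: multiplier_cst|exact: mF].
  by apply/funext => x; rewrite big_ord_recr.
- move=> N x; set p := \prod_(k < N) _.
  have p0 : 0 <= p.
    by apply: prodr_ge0 => k _; rewrite indicE; case: (_ \in _) => /=; lra.
  have p1 : p <= 1.
    by apply: prodr_ile1 => k _; rewrite indicE; case: (_ \in _) => /=; apply/andP; split; lra.
  by rewrite ger0_norm; lra.
- move=> x; rewrite indicE.
  have [xF|xF] := pselect ((\bigcup_k F k) x); last first.
    rewrite memNset//= (_ : (fun N => _) = cst 0); first exact: cvg_cst.
    apply/funext => N; rewrite big1 => [|k _]; first by rewrite /cst; ring.
    by rewrite indicE memNset /=; [ring|move=> Fk; apply: xF; exists k].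
  rewrite mem_set//=; have [k _ Fk] := xF.
  apply: cvg_near_cst; near=> N.
  have kN : (k < N)%N by near: N; exact: nbhs_infty_gt.
  by rewrite (bigD1 (Ordinal kN))//= indicE mem_set//=; ring.
Unshelve. all: by end_near. Qed.

Let sigma_mset : sigma_algebra [set: n.-tuple R] mset.
Proof.
split.
- rewrite /mset indic0; exact: multiplier_cst.
- by move=> A mA; rewrite setTD; exact: msetC.
- exact: mset_bigcup.
Qed.

(** For each [x], the sine of [(tnth x i - c) / k.+1] has the sign of [tnth x i - c] as soon as [k]
    is large enough for the argument to lie within (-pi, pi). *)
Let mset_ray (i : 'I_n) (c : R) : mset [set x | c < tnth x i].
Proof.
(* The open half-space is the limit inferior of these sets. *)
pose S k := [set x : n.-tuple R | 0 < sin ((tnth x i - c) / k.+1%:R)].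
have mS k : mset (S k).
  pose a := [tuple (if j == i then (k.+1%:R)^-1 else 0 : R) | j < n].
  (* The phase shift by [pi / 2] turns the cosine of [wave] into the sine of [S k]. *)
  pose b := - c / k.+1%:R - pi / 2.
  rewrite (_ : S k = [set x | 0 < wave a b x]).
    apply: mset_pos; first exact: multiplier_wave.
    by move=> x; rewrite ler_norml cos_geN1 cos_le1.
  apply/funext => x; rewrite /S /= /wave; congr (_ < _ : Prop).
  have -> : dotv a x = tnth x i / k.+1%:R.
    rewrite /dotv (bigD1 i)//= tnth_mktuple eqxx mulrC big1 ?addr0// => j ji.
    by rewrite tnth_mktuple (negbTE ji) mul0r.
  rewrite /b addrA -mulrDl cosB cos_pihalf sin_pihalf; ring.
rewrite (_ : [set x | _] = \bigcup_N ~` (\bigcup_k ~` S (N + k)%N)).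
  by apply: mset_bigcup => N; apply: msetC; apply: mset_bigcup => k; apply: msetC.
have inpi (t : R) : exists N, forall k, `|t / (N + k).+1%:R| < pi.
  exists (Num.bound `|t / pi|) => k.
  rewrite normrM [X in _ * X]ger0_norm ?invr_ge0// ltr_pdivrMr//.
  rewrite mulrC -ltr_pdivrMr ?pi_gt0// -[X in _ / X](gtr0_norm (pi_gt0 R)) -normf_div.
  by apply: lt_le_trans (archi_boundP (normr_ge0 _)) _; rewrite ler_nat leqW// leq_addr.
apply/seteqP; split=> x /=.
  move=> cx; have [N hN] := inpi (tnth x i - c).
  exists N => // -[k _]; apply; rewrite /S /=.
  have := hN k; rewrite gtr0_norm; last by rewrite divr_gt0// subr_gt0.
  by move=> h; apply: sin_gt0_pi; rewrite h andbT divr_gt0// subr_gt0.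
move=> [N _ hN]; rewrite ltNge; apply/negP => xc.
have [N' hN'] := inpi (tnth x i - c).
apply: hN; exists N' => //= h.
have := hN' N; rewrite addnC => h'.
have : 0 <= sin (- ((tnth x i - c) / (N + N').+1%:R)).
  apply: sin_ge0_pi; apply/andP; split.
    by rewrite oppr_ge0 mulr_le0_ge0 ?subr_le0// invr_ge0.
  by apply: le_trans (ltW h'); rewrite -normrN ler_norm.
by rewrite sinN oppr_ge0 leNgt h.
Qed.

Theorem cramer_wold (A : set (n.-tuple R)) : measurable A -> mu A = nu A.
Proof.
move=> mA; have : mset A.
  move: A mA; apply: smallest_sub; first exact: sigma_mset.
  have H (i : 'I_n) : preimage_set_system setT (fun x : n.-tuple R => tnth x i) measurable `<=` mset.
    move=> _ [B mB <-]; rewrite setTI.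
    pose f := fun x : n.-tuple R => tnth x i.
    suff : @measurable _ (measurableTypeR R) `<=` image_set_system setT f mset.
      by move=> /(_ _ mB); rewrite /image_set_system/= setTI.
    rewrite RGenOInfty.measurableE.
    apply: smallest_sub; first exact: sigma_algebra_image.
    move=> _ [c ->]; rewrite /image_set_system/= setTI.
    rewrite (_ : _ @^-1` _ = [set x | c < tnth x i]); first exact: mset_ray.
    by apply/funext => x /=; rewrite in_itv/= andbT.
  apply: (big_ind (fun G : set (set (n.-tuple R)) => G `<=` mset)).
  - by move=> ? [].
  - by move=> A B hA hB C [/hA|/hB].
  - by move=> i _; exact: H.
(* The product of the constant 1 and the multiplier [\1_A] is tame; testing it against the wave of
   frequency and phase 0, which is constantly 1, compares the measures of [A]. *)
move=> [_ _ /(_ _ tame1)[_ _ /(_ [tuple 0 | i < n] 0)]].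
have E (P : probability (n.-tuple R) R) :
    \int[P]_x (cst 1 x * \1_A x * wave [tuple 0 | i < n] 0 x) = fine (P A).
  rewrite -[in RHS](setIT A) -integral_indic//; congr fine.
  apply: eq_integral => x _; congr EFin.
  rewrite /wave (_ : dotv _ x = 0) ?addr0 ?cos0 ?mulr1 ?mul1r//.
  by rewrite /dotv big1// => i _; rewrite tnth_mktuple mul0r.
rewrite !E => h; rewrite -[LHS]fineK ?fin_num_measure// -[RHS]fineK ?fin_num_measure//.
by rewrite h.
Qed.
End cramer_wold.

(** * Second moments and projections of Gaussian vectors *)

Section square_integrable.
Context {d : measure_display} {T : measurableType d} {R : realType}.
Variable P : probability T R.
Local Open Scope ereal_scope.

Lemma square_integrableM (f h : T -> R) :
  measurable_fun [set: T] f -> measurable_fun [set: T] h ->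
  P.-integrable [set: T] (fun w => (f w ^+ 2)%:E) ->
  P.-integrable [set: T] (fun w => (h w ^+ 2)%:E) ->
  P.-integrable [set: T] (fun w => (f w * h w)%:E).
Proof.
move=> mf mh f2 h2.
apply: (@le_integrable _ _ _ P _ _ _ (fun w => (f w ^+ 2 + h w ^+ 2)%:E)) => //.
- by apply/measurable_EFinP; exact: measurable_funM.
- move=> w _ /=; rewrite lee_fin [leRHS]ger0_norm; last by rewrite addr_ge0 ?sqr_ge0.
  rewrite normrM -(real_normK (num_real (f w))) -(real_normK (num_real (h w))).
  have := sqr_ge0 (`|f w| - `|h w|)%R; have := mulr_ge0 (normr_ge0 (f w)) (normr_ge0 (h w)).
  rewrite sqrrB; lra.
- by under eq_fun do rewrite EFinD; exact: integrableD.
Qed.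

Lemma square_integrable_integrable (f : T -> R) : measurable_fun [set: T] f ->
  P.-integrable [set: T] (fun w => (f w ^+ 2)%:E) ->
  P.-integrable [set: T] (fun w => (f w)%:E).
Proof.
move=> mf f2; have := @square_integrableM f (cst 1%R) mf (measurable_cst _) f2.
rewrite (_ : (fun w => (f w * cst 1 w)%:E) = (fun w => (f w)%:E))%R; last first.
  by apply/funext => w; rewrite mulr1.
by apply; under eq_fun do rewrite expr1n; exact: finite_measure_integrable_cst.
Qed.

End square_integrable.

Section gaussian_projections.
Context {d : measure_display} {T : measurableType d} {R : realType} {M : nat}.
Variables (P : probability T R) (X : {mfun T >-> M.-tuple R}) (lam : 'I_M -> R).
Hypothesis covX : centered_with_diag_cov P X lam.
Local Open Scope ereal_scope.

Lemma measurable_coord i : measurable_fun [set: T] (fun w => tnth (X w) i).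
Proof. exact: (measurableT_comp (measurable_tnth i) (measurable_funPT X)). Qed.

Lemma centered_square i : P.-integrable [set: T] (fun w => ((tnth (X w) i) ^+ 2)%:E).
Proof. by have [h _ _] := covX. Qed.

Lemma centered_integrableM i j :
  P.-integrable [set: T] (fun w => (tnth (X w) i * tnth (X w) j)%:E).
Proof.
by apply: square_integrableM; try exact: measurable_coord; exact: centered_square.
Qed.

Lemma centered_integrable i : P.-integrable [set: T] (fun w => (tnth (X w) i)%:E).
Proof.
by apply: square_integrable_integrable; [exact: measurable_coord|exact: centered_square].
Qed.

Lemma centered_mean i : \int[P]_w (tnth (X w) i)%:E = 0.
Proof. by have [_ /(_ i) + _] := covX; rewrite unlock. Qed.

Lemma centered_cov i j :
  \int[P]_w (tnth (X w) i * tnth (X w) j)%:E = (if i == j then lam i else 0%R)%:E.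
Proof.
have [_ m0 /(_ i j) <-] := covX; rewrite covariance.unlock !m0 unlock.
apply: eq_integral => w _.
by rewrite -[RHS]/(((tnth (X w) i - 0) * (tnth (X w) j - 0))%:E) !subr0.
Qed.

Lemma measurable_dotvX a : measurable_fun [set: T] (fun w => dotv a (X w)).
Proof. exact: (measurableT_comp (measurable_dotv a) (measurable_funPT X)). Qed.

Lemma dotv_mean a : \int[P]_w (dotv a (X w))%:E = 0.
Proof.
under eq_integral do rewrite /dotv -sumEFin.
rewrite integral_sum//; last first.
  by move=> i; under eq_fun do rewrite EFinM; apply: integrableZl => //; exact: centered_integrable.
rewrite big1// => i _; under eq_integral do rewrite EFinM.
by rewrite integralZl//; [rewrite centered_mean mule0|exact: centered_integrable].
Qed.

Let dotv2E a w : ((dotv a (X w)) ^+ 2)%:E =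
  \sum_(i < M) \sum_(j < M) ((tnth a i * tnth a j) * (tnth (X w) i * tnth (X w) j))%:E.
Proof.
rewrite /dotv expr2 big_distrlr/= -sumEFin; apply: eq_bigr => i _.
by rewrite -sumEFin; apply: eq_bigr => j _; congr EFin; ring.
Qed.

Let iaa a i j : P.-integrable [set: T]
  (fun w => ((tnth a i * tnth a j) * (tnth (X w) i * tnth (X w) j))%:E).
Proof.
by under eq_fun do rewrite EFinM; apply: integrableZl => //; exact: centered_integrableM.
Qed.

Lemma dotv_square_integrable a : P.-integrable [set: T] (fun w => ((dotv a (X w)) ^+ 2)%:E).
Proof.
under eq_fun do rewrite dotv2E.
by apply: integrable_sum => // i _; apply: integrable_sum => // j _; exact: iaa.
Qed.

Lemma dotv_variance a :
  \int[P]_w ((dotv a (X w)) ^+ 2)%:E = (\sum_(i < M) (tnth a i) ^+ 2 * lam i)%:E.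
Proof.
under eq_integral do rewrite dotv2E.
rewrite integral_sum//; last by move=> i; apply: integrable_sum => // j _; exact: iaa.
rewrite -sumEFin; apply: eq_bigr => i _.
rewrite integral_sum//.
rewrite (bigD1 i)//= big1 ?adde0 => [|j ji].
  under eq_integral do rewrite EFinM.
  rewrite integralZl//; last exact: centered_integrableM.
  by rewrite centered_cov eqxx -EFinM expr2.
under eq_integral do rewrite EFinM.
rewrite integralZl//; last exact: centered_integrableM.
by rewrite centered_cov eq_sym (negbTE ji) mule0.
Qed.

Hypothesis gX : gaussian_vector P X.
Hypothesis lam0 : forall i, (0 <= lam i)%R.

Lemma gaussian_projection a (F : R -> \bar R) : measurable_fun [set: R] F ->
  (forall x, 0 <= F x) ->
  \int[P]_w F (dotv a (X w)) =
  \int[std_gauss]_u F (Num.sqrt (\sum_(i < M) (tnth a i * Num.sqrt (lam i)) ^+ 2) * u)%R.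
Proof.
(* A point mass is the case [s = 0] of the same formula, so degenerate and non-degenerate
   projections are identified together by their first two moments. *)
have [m [s [s0 YE]]] : exists m s : R, (0 <= s)%R /\ forall F : R -> \bar R,
    measurable_fun [set: R] F -> (forall x, 0 <= F x) ->
    \int[P]_w F (dotv a (X w)) = \int[std_gauss]_u F (m + s * u)%R.
  have [[m Pm]|[m [s [s0 Ps]]]] := gX a; last first.
    exists m, s; split; first exact: ltW.
    by apply: normal_law_functional => //; exact: measurable_dotvX.
  exists m, 0%R; split => // G mG G0.
  have PA : P (~` ((fun w => dotv a (X w)) @^-1` [set m])) = 0.
    have mA : measurable ((fun w => dotv a (X w)) @^-1` [set m]).
      rewrite -[X in measurable X]setTI; apply: measurable_dotvX => //.
    by rewrite probability_setC// Pm subee.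
  transitivity (\int[P]_w G m).
    apply: ge0_ae_eq_integral => //.
    - exact: (measurableT_comp mG (measurable_dotvX a)).
    - exists (~` ((fun w => dotv a (X w)) @^-1` [set m])); split => //.
      + apply: measurableC; rewrite -[X in measurable X]setTI; apply: measurable_dotvX => //.
      + by move=> w /= h e; apply: h => _; rewrite e.
  under [RHS]eq_integral do rewrite mul0r addr0.
  by rewrite !integral_cst//; congr (_ * _); apply: etrans (probability_setT _) (esym (probability_setT _)).
have m0 : m = 0%R.
  apply: (@normal_mean _ _ _ P (fun w => dotv a (X w)) m s) => //.
  - exact: measurable_dotvX.
  - exact: dotv_square_integrable.
  - exact: dotv_mean.
have vE : (\sum_(i < M) (tnth a i) ^+ 2 * lam i = s ^+ 2)%R.
  apply: (@normal_variance _ _ _ P (fun w => dotv a (X w)) m s) => //.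
  - exact: measurable_dotvX.
  - exact: dotv_square_integrable.
  - exact: dotv_variance.
move=> mF F0; rewrite YE// m0; apply: eq_integral => u _; rewrite add0r; congr (F (_ * _)%R).
rewrite -[LHS]ger0_norm// -sqrtr_sqr -vE; congr Num.sqrt.
by apply: eq_bigr => i _; rewrite exprMn sqr_sqrtr.
Qed.
End gaussian_projections.

(** * The Gaussian channel *)

Section joint_density.
Context {d d1 d2 : measure_display} {T : measurableType d}
  {T1 : measurableType d1} {T2 : measurableType d2} {R : realType}.
Variables (P : probability T R) (X : {mfun T >-> T1}) (Y : {mfun T >-> T2}).
Local Open Scope ereal_scope.

(** Formulated with iterated integrals of non-negative functions, the form in which conditioning the
    channel on its input delivers the density. *)
Definition joint_density (q : T1 * T2 -> R) :=
  [/\ measurable_fun [set: T1 * T2] q, (forall p, (0 <= q p)%R) &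
  forall F : T1 * T2 -> \bar R, measurable_fun [set: T1 * T2] F -> (forall p, 0 <= F p) ->
  \int[P]_w F (X w, Y w) =
  \int[distribution P X]_x \int[distribution P Y]_y (F (x, y) * (q (x, y))%:E)].

Let XY : probability _ R := distribution P X \x distribution P Y.
Let J : probability _ R := distribution P (pairf X Y).

Lemma joint_density_has_density q : joint_density q -> has_density J XY q.
Proof.
move=> [mq q0 qE]; split => // A mA.
have m1 : measurable_fun [set: T1 * T2] (fun p => (\1_A p)%:E : \bar R).
  by apply/measurable_EFinP; exact: measurable_indic.
have mF : measurable_fun [set: T1 * T2] (fun p => (\1_A p)%:E * (q p)%:E).
  by apply: emeasurable_funM => //; exact/measurable_EFinP.
transitivity (\int[J]_p (\1_A p)%:E); first by rewrite integral_indic// setIT.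
rewrite ge0_integral_distribution//.
rewrite [LHS](qE (fun p => (\1_A p)%:E))//.
rewrite [RHS]integral_mkcond.
transitivity (\int[XY]_p ((\1_A p)%:E * (q p)%:E)); last first.
  apply: eq_integral => p _; rewrite patchE indicE.
  by case: ifPn => _; rewrite ?mul1e ?mul0e.
by rewrite (fubini_tonelli1 _ mF)// => p; rewrite mule_ge0// lee_fin.
Qed.

Lemma mutual_info_joint_density q : joint_density q ->
  mutual_info P X Y = \int[J]_p (log2 (q p))%:E.
Proof. by move=> /joint_density_has_density; exact: KL_density. Qed.
End joint_density.

Section independence.
Context {d d1 d2 : measure_display} {T : measurableType d}
  {T1 : measurableType d1} {T2 : measurableType d2} {R : realType}.
Variables (P : probability T R) (X : {mfun T >-> T1}) (Y : {mfun T >-> T2}).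
Hypothesis indep : independent P X Y.
Local Open Scope ereal_scope.

Lemma independent_integral (F : T1 * T2 -> \bar R) :
  measurable_fun [set: T1 * T2] F -> (forall p, 0 <= F p) ->
  \int[P]_w F (X w, Y w) = \int[P]_w \int[P]_v F (X w, Y v).
Proof.
move=> mF F0.
have mG : measurable_fun [set: T1] (fun x => \int[distribution P Y]_y F (x, y)).
  exact: measurable_fun_fubini_tonelli_F.
transitivity (\int[distribution P (pairf X Y)]_p F p); first by rewrite ge0_integral_distribution.
transitivity (\int[distribution P X \x distribution P Y]_p F p).
  apply: eq_measure_integral => A mA _; by apply/esym; apply: product_measure_unique.
rewrite (fubini_tonelli1 _ mF F0) ge0_integral_distribution//; last first.
  by move=> x; apply: integral_ge0.
apply: eq_integral => w _; rewrite /= /fubini_F ge0_integral_distribution//.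
exact: (measurableT_comp mF (pair1_measurable (X w))).
Qed.
End independence.

Section gauss_vec.
Context {R : realType} {M : nat}.
Local Open Scope ereal_scope.

Section scaling.
Variable s : 'I_M -> R.
Definition vscale : M.-tuple R -> M.-tuple R := vaff (fun=> 0%R) s.
Lemma measurable_vscale : measurable_fun [set: M.-tuple R] vscale.
Proof.
exact: (measurable_vaff (a := fun=> fun=> 0%R) _ (fun i => measurable_cst _) (@measurable_id _ _ _)).
Qed.
HB.instance Definition _ := @isMeasurableFun.Build _ _ _ _ vscale measurable_vscale.

Definition gauss_vec : probability (M.-tuple R) R :=
  distribution (std_gauss_tuple M) vscale.
End scaling.

Lemma ge0_integral_gauss_vec s (F : M.-tuple R -> \bar R) :
  measurable_fun [set: M.-tuple R] F -> (forall x, 0 <= F x) ->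
  \int[gauss_vec s]_x F x = \int[std_gauss_tuple M]_u F (vscale s u).
Proof. by move=> mF F0; rewrite ge0_integral_distribution. Qed.

(** [std_gauss_tuple_rotation] identifies the assumed projections with those of [gauss_vec s], and
    [cramer_wold] applies. *)
Lemma gauss_vec_projection s (mu : probability (M.-tuple R) R) :
  (forall (a : M.-tuple R) (F : R -> \bar R), measurable_fun [set: R] F ->
    (forall x, 0 <= F x) -> \int[mu]_x F (dotv a x) =
    \int[std_gauss]_u F (Num.sqrt (\sum_(i < M) (tnth a i * s i) ^+ 2) * u)%R) ->
  forall A, measurable A -> mu A = gauss_vec s A.
Proof.
move=> muE A mA; apply: cramer_wold => // a G mG G0.
have mGa : measurable_fun [set: M.-tuple R] (fun x => G (dotv a x)).
  exact: (measurableT_comp mG (measurable_dotv a)).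
rewrite muE// ge0_integral_gauss_vec// -std_gauss_tuple_rotation//.
apply: eq_integral => u _; congr G; rewrite /dotv; apply: eq_bigr => i _.
by rewrite /vscale tnth_mktuple add0r mulrA.
Qed.

Lemma gaussian_gauss_vec d (T : measurableType d) (P : probability T R)
    (X : {mfun T >-> M.-tuple R}) (lam : 'I_M -> R) :
  centered_with_diag_cov P X lam -> gaussian_vector P X -> (forall i, 0 <= lam i)%R ->
  forall A, measurable A ->
  distribution P X A = gauss_vec (fun i => Num.sqrt (lam i)) A.
Proof.
move=> cX gX lam0 A mA; apply: gauss_vec_projection => // a F mF F0.
rewrite ge0_integral_distribution; last 2 first.
- exact: (measurableT_comp mF (measurable_dotv a)).
- by [].
exact: gaussian_projection.
Qed.
End gauss_vec.

Section channel.
Context {d : measure_display} {T : measurableType d} {R : realType} {M : nat}.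
Variables (P : probability T R) (X U Z : {mfun T >-> M.-tuple R}).
Variables (lam : 'I_M -> R) (a b : 'I_M -> R).
Hypothesis lam0 : forall i, (0 < lam i)%R.
Hypothesis b0 : forall i, (0 < b i)%R.
Hypothesis ab : forall i, (a i ^+ 2 * lam i + b i ^+ 2 = lam i)%R.
Hypothesis covX : centered_with_diag_cov P X lam.
Hypothesis gU : gaussian_vector P U.
Hypothesis covU : centered_with_diag_cov P U (fun=> 1%R).
Hypothesis indep : independent P X U.
Hypothesis ZE : forall w i, tnth (Z w) i = (a i * tnth (X w) i + b i * tnth (U w) i)%R.
Local Open Scope ereal_scope.

Let s i := Num.sqrt (lam i).
Let s0 i : (0 < s i)%R. Proof. by rewrite sqrtr_gt0. Qed.
Let mus : probability _ R := gauss_vec s.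

Let mZ (x : M.-tuple R) (u : M.-tuple R) := vaff (fun i => (a i * tnth x i)%R) b u.

(** The [q] of the overview: the density, relative to the Gaussian law [mus], of the conditional law
    of [Z] given [X = p.1]. *)
Let channel_ratio (p : M.-tuple R * M.-tuple R) : R :=
  vratio (fun i => (a i * tnth p.1 i)%R) b s p.2.

Let measurable_ax i : measurable_fun [set: M.-tuple R * M.-tuple R]
  (fun p => (a i * tnth p.1 i)%R).
Proof.
by apply: measurable_funM => //; exact: (measurableT_comp (measurable_tnth i) measurable_fst).
Qed.

Lemma measurable_channel_ratio :
  measurable_fun [set: M.-tuple R * M.-tuple R] channel_ratio.
Proof.
by apply: measurable_vratio; [exact: measurable_ax|exact: measurable_snd].
Qed.

Lemma channel_ratio_gt0 p : (0 < channel_ratio p)%R.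
Proof. exact: vratio_gt0. Qed.

Lemma integral_noise (F : M.-tuple R -> \bar R) : measurable_fun [set: M.-tuple R] F ->
  (forall u, 0 <= F u) -> \int[P]_w F (U w) = \int[std_gauss_tuple M]_u F u.
Proof.
move=> mF F0; transitivity (\int[distribution P U]_u F u).
  by rewrite ge0_integral_distribution.
transitivity (\int[gauss_vec (fun i : 'I_M => Num.sqrt 1)]_u F u).
  apply: eq_measure_integral => A mA _.
  exact: (gaussian_gauss_vec covU gU (fun=> ler01)).
rewrite ge0_integral_gauss_vec//.
apply: eq_integral => u _; congr F; apply: eq_from_tnth => i.
by rewrite tnth_mktuple sqrtr1 mul1r add0r.
Qed.

(** Independence allows [X] to be frozen; [Z] is then an affine image of standard normal noise, and
    [std_gauss_tuple_shift] moves it to the reference law [mus]. *)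
Lemma channel_integral (F : M.-tuple R * M.-tuple R -> \bar R) :
  measurable_fun [set: M.-tuple R * M.-tuple R] F -> (forall p, 0 <= F p) ->
  \int[P]_w F (X w, Z w) =
  \int[distribution P X]_x \int[mus]_z (F (x, z) * (channel_ratio (x, z))%:E).
Proof.
move=> mF F0.
have mch : measurable_fun [set: M.-tuple R * M.-tuple R] (fun p => (p.1, mZ p.1 p.2)).
  by apply: measurable_fun_pair => //; apply: measurable_vaff; [exact: measurable_ax|exact: measurable_snd].
have mFch := measurableT_comp mF mch.
transitivity (\int[P]_w F (X w, mZ (X w) (U w))).
  apply: eq_integral => w _; congr (F (_, _)); apply: eq_from_tnth => i.
  by rewrite ZE tnth_mktuple.
rewrite (independent_integral indep (F := fun p => F (p.1, mZ p.1 p.2)))//.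
have mFq : measurable_fun [set: M.-tuple R * M.-tuple R]
    (fun p => F p * (channel_ratio p)%:E).
  by apply: emeasurable_funM => //; apply/measurable_EFinP; exact: measurable_channel_ratio.
have Fq0 p : 0 <= F p * (channel_ratio p)%:E.
  by rewrite mule_ge0// lee_fin ltW// channel_ratio_gt0.
rewrite ge0_integral_distribution; last 2 first.
- exact: (measurable_fun_fubini_tonelli_F _ mFq).
- by move=> x; exact: integral_ge0.
apply: eq_integral => w _ /=.
have mFx : measurable_fun [set: M.-tuple R] (fun z => F (X w, z)).
  exact: (measurableT_comp mF (pair1_measurable (X w))).
rewrite (integral_noise (F := fun u => F (X w, mZ (X w) u)))//; last first.
  exact: (measurableT_comp mFch (pair1_measurable (X w))).
rewrite (std_gauss_tuple_shift _ b0 s0 mFx)// ge0_integral_gauss_vec//.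
exact: (measurableT_comp mFq (pair1_measurable (X w))).
Qed.

Lemma independent_square (c e : R) i :
  \int[P]_w ((c * tnth (X w) i + e * tnth (U w) i) ^+ 2)%:E = (c ^+ 2 * lam i + e ^+ 2)%:E.
Proof.
rewrite (independent_integral indep (F := fun p => ((c * tnth p.1 i + e * tnth p.2 i) ^+ 2)%:E)); last 2 first.
- apply/measurable_EFinP/measurable_funX/measurable_funD; apply: measurable_funM => //.
    exact: (measurableT_comp (measurable_tnth i) measurable_fst).
  exact: (measurableT_comp (measurable_tnth i) measurable_snd).
- by move=> p; rewrite lee_fin sqr_ge0.
have iU2 : P.-integrable [set: T] (fun w => (tnth (U w) i * tnth (U w) i)%:E).
  exact: (centered_integrableM covU i i).
have iU := centered_integrable covU i.
have cst1 := integral_prob_cst P.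
transitivity (\int[P]_w ((c ^+ 2)%:E * (tnth (X w) i * tnth (X w) i)%:E + (e ^+ 2)%:E)).
  apply: eq_integral => w _ /=.
  transitivity (\int[P]_v (((c * tnth (X w) i) ^+ 2)%:E +
     ((2 * c * tnth (X w) i * e)%:E * (tnth (U v) i)%:E + (e ^+ 2)%:E * (tnth (U v) i * tnth (U v) i)%:E))).
    by apply: eq_integral => v _; rewrite -!EFinM -!EFinD; congr EFin; ring.
  rewrite integralD//; last 2 first.
  - exact: finite_measure_integrable_cst.
  - by apply: integrableD => //; exact: integrableZl.
  rewrite integralD//; [|exact: integrableZl|exact: integrableZl].
  rewrite cst1 integralZl// integralZl// (centered_mean covU) mule0 add0e.
  by rewrite (centered_cov covU) eqxx mule1 -EFinM; congr (EFin _ + _); ring.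
rewrite integralD//; last 2 first.
- by apply: integrableZl => //; exact: (centered_integrableM covX).
- exact: finite_measure_integrable_cst.
rewrite integralZl//; last exact: (centered_integrableM covX).
by rewrite (centered_cov covX) eqxx cst1 -EFinM -EFinD.
Qed.

Lemma channel_square (c e : R) i :
  \int[P]_w ((c * tnth (X w) i + e * tnth (Z w) i) ^+ 2)%:E =
  ((c + e * a i) ^+ 2 * lam i + (e * b i) ^+ 2)%:E.
Proof.
rewrite -independent_square; apply: eq_integral => w _.
by rewrite ZE; congr EFin; ring.
Qed.

(** Each summand is half the logarithm of output variance over noise variance, the information of a
    scalar Gaussian channel. *)
Definition channel_rate : R := ((\sum_(i < M) ln (s i / b i)) / ln 2)%R.

Let lnr (p : M.-tuple R * M.-tuple R) : R := (\sum_(i < M) (ln (s i / b i) +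
   (tnth p.2 i) ^+ 2 / (2 * s i ^+ 2) - (tnth p.2 i - a i * tnth p.1 i) ^+ 2 / (2 * b i ^+ 2)))%R.

Let log2_channel_ratio p : log2 (channel_ratio p) = (lnr p / ln 2)%R.
Proof.
rewrite /log2 /channel_ratio /vratio; congr (_ / _)%R.
suff : channel_ratio p = expR (lnr p) by rewrite /channel_ratio /vratio => ->; rewrite expRK.
rewrite /lnr expR_sum; apply: eq_bigr => i _.
rewrite -addrA expRD lnK// posrE divr_gt0//.
Qed.

Lemma integrable_square_combination c e i :
  P.-integrable [set: T] (fun w => ((c * tnth (X w) i + e * tnth (Z w) i) ^+ 2)%:E).
Proof.
apply/integrableP; split.
  apply/measurable_EFinP/measurable_funX/measurable_funD; apply: measurable_funM => //; exact: measurable_coord.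
under eq_integral do rewrite gee0_abs ?lee_fin ?sqr_ge0//.
by rewrite channel_square ltry.
Qed.

(** The two quadratic terms of each coordinate cancel in the mean: by [ab] the second moment of the
    output is [lam i], that of the noise part is [b i ^+ 2], and each divided by twice itself is
    1/2. *)
Lemma integral_log2_channel_ratio :
  P.-integrable [set: T] (fun w => (log2 (channel_ratio (X w, Z w)))%:E) /\
  \int[P]_w (log2 (channel_ratio (X w, Z w)))%:E = channel_rate%:E.
Proof.
pose term i w : \bar R := (ln (s i / b i))%:E +
  ((2 * s i ^+ 2)^-1%:E * ((0 * tnth (X w) i + 1 * tnth (Z w) i) ^+ 2)%:E +
   (- (2 * b i ^+ 2)^-1)%:E * ((- a i * tnth (X w) i + 1 * tnth (Z w) i) ^+ 2)%:E).
have cst1 := integral_prob_cst P.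
have E w : (log2 (channel_ratio (X w, Z w)))%:E = (\sum_(i < M) term i w) * (ln 2)^-1%:E.
  rewrite log2_channel_ratio EFinM; congr (_ * _).
  rewrite /lnr -sumEFin; apply: eq_bigr => i _.
  by rewrite /term -!EFinM -!EFinD; congr EFin => /=; ring.
have iterm i : P.-integrable [set: T] (term i).
  apply: integrableD => //; first exact: finite_measure_integrable_cst.
  by apply: integrableD => //; apply: integrableZl => //; exact: integrable_square_combination.
have isum : P.-integrable [set: T] (fun w => \sum_(i < M) term i w).
  by apply: integrable_sum => // i _; exact: iterm.
split.
  by under eq_fun do rewrite E; exact: integrableZr.
under eq_integral do rewrite E.
rewrite integralZr// integral_sum//.
rewrite (_ : \sum_(i < M) _ = (\sum_(i < M) ln (s i / b i))%:E)//.
rewrite -sumEFin; apply: eq_bigr => i _.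
have i1 c e := integrable_square_combination c e i.
rewrite integralD//; last 2 first.
- exact: finite_measure_integrable_cst.
- by apply: integrableD => //; apply: integrableZl.
rewrite integralD//; [|exact: integrableZl|exact: integrableZl].
rewrite cst1 !integralZl// !channel_square -!EFinM -!EFinD; congr EFin.
rewrite [RHS](_ : _ = ln (s i / b i) + 0)%R; last by rewrite addr0.
have e1 : ((0 + 1 * a i) ^+ 2 * lam i + (1 * b i) ^+ 2 = lam i)%R.
  by rewrite -[RHS](ab i); ring.
have e2 : ((- a i + 1 * a i) ^+ 2 * lam i + (1 * b i) ^+ 2 = b i ^+ 2)%R by ring.
congr (_ + _)%R; rewrite e1 e2.
rewrite sqr_sqrtr ?ltW//; field.
by rewrite !gt_eqF.
Qed.

(** Each conditional law of [Z] given [X = x] has a density relative to [mus], so it does not charge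
    [mus]-null sets. *)
Lemma channel_dominates : distribution P Z `<< mus.
Proof.
apply/null_content_dominatesP => A mA A0.
have mind : measurable_fun [set: M.-tuple R] (fun z => (\1_A z)%:E : \bar R).
  by apply/measurable_EFinP; exact: measurable_indic.
transitivity (\int[distribution P Z]_z (\1_A z)%:E); first by rewrite integral_indic// setIT.
rewrite ge0_integral_distribution//.
rewrite [LHS](channel_integral (F := fun p => (\1_A p.2)%:E)); last 2 first.
- exact: (measurableT_comp mind measurable_snd).
- by move=> p; rewrite lee_fin.
rewrite (eq_integral (cst 0)) ?integral0// => x _.
transitivity (\int[mus]_(z in A) (channel_ratio (x, z))%:E).
  rewrite [RHS]integral_mkcond; apply: eq_integral => z _.
  by rewrite patchE indicE /=; case: ifPn => _; rewrite ?mul1e ?mul0e.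
apply: null_set_integral => //; apply/measurable_EFinP/measurable_funTS.
exact: (measurableT_comp measurable_channel_ratio (pair1_measurable x)).
Qed.

(** With [h] the density of the law of [Z] relative to [mus], the joint law has density
    [channel_ratio / h] relative to the product of its marginals. The two logarithms add up to that
    of [channel_ratio], whose mean is known. *)
Lemma channel_information :
  KL (distribution P Z) mus \is a fin_num /\
  mutual_info P X Z + KL (distribution P Z) mus = channel_rate%:E.
Proof.
have [h hZ] := dominates_has_density channel_dominates.
have [mh h0 _] := hZ.
pose N := h @^-1` [set 0%R].
have mN : measurable N.
  by rewrite -[X in measurable X]setTI; apply: mh => //; exact: measurable_set1.
(* As [ln 0 = 0], replacing the value 0 of h by 1 does not change log2 h. *)
pose k z := (h z + \1_N z)%R.
have kE z : k z = if h z == 0%R then 1%R else h z.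
  rewrite /k indicE; have [hz|hz] := eqVneq (h z) 0%R.
    by rewrite mem_set//= hz add0r.
  by rewrite memNset ?addr0//= => /eqP; rewrite (negbTE hz).
have k0 z : (0 < k z)%R.
  by rewrite kE; case: eqVneq => // hz; rewrite lt_neqAle eq_sym hz h0.
have mk : measurable_fun [set: M.-tuple R] k.
  by apply: measurable_funD => //; exact: measurable_indic.
have log2k z : log2 (k z) = log2 (h z).
  by rewrite kE; case: eqVneq => // ->; rewrite /log2 ln1 (ln0 (lexx (0%R : R))).
pose r p := (channel_ratio p / k p.2)%R.
have mk2 : measurable_fun [set: M.-tuple R * M.-tuple R] (fun p => k p.2).
  exact: (measurableT_comp mk measurable_snd).
have mr : measurable_fun [set: M.-tuple R * M.-tuple R] r.
  apply: measurable_funM; first exact: measurable_channel_ratio.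
  by apply: measurable_funV_ge0 => // p; exact: ltW.
have r0 p : (0 < r p)%R by rewrite divr_gt0// channel_ratio_gt0.
have jr : joint_density P X Z r.
  split; [exact: mr|by move=> p; exact: ltW|move=> F mF F0].
  (* [r * h] equals [channel_ratio] only off the zero set [N] of [h]. As [Z] almost surely avoids
     [N], the test function may be cut off there. *)
  pose F' p := F p * (\1_(~` N) p.2)%:E.
  have mF' : measurable_fun [set: M.-tuple R * M.-tuple R] F'.
    apply: emeasurable_funM => //; apply/measurable_EFinP.
    by apply: (measurableT_comp _ measurable_snd); apply: measurable_indic; exact: measurableC.
  have F'0 p : 0 <= F' p by rewrite mule_ge0// lee_fin.
  transitivity (\int[P]_w F' (X w, Z w)).
    apply: ge0_ae_eq_integral => //.
    - exact: (measurableT_comp mF (measurable_fun_pair (measurable_funPT X) (measurable_funPT Z))).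
    - exact: (measurableT_comp mF' (measurable_fun_pair (measurable_funPT X) (measurable_funPT Z))).
    - have [N' [mN' N'0 sN']] := has_density_ae_gt0 hZ.
      exists (Z @^-1` N'); split => //.
        by rewrite -[X in measurable X]setTI; exact: measurable_funPT.
      move=> w /= hw; apply: sN' => /= hZw; apply: hw => _.
      rewrite /F' indicE in_setC memNset ?mule1//= => hz.
      by move: hZw; rewrite hz ltxx.
  rewrite (channel_integral mF' F'0); apply: eq_integral => x _.
  rewrite (ge0_integral_density hZ); last 2 first.
  - apply: emeasurable_funM; first exact: (measurableT_comp mF (pair1_measurable x)).
    by apply/measurable_EFinP; exact: (measurableT_comp mr (pair1_measurable x)).
  - by move=> z; rewrite mule_ge0// lee_fin ltW.
  apply: eq_integral => z _; rewrite /F' -!muleA -!EFinM; congr (_ * EFin _).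
  rewrite /r /= kE indicE in_setC; case: eqVneq => hz.
    by rewrite mem_set//= hz mulr0 mul0r.
  by rewrite memNset/= ?mul1r ?divfK// => /eqP; rewrite (negbTE hz).
have Jr := joint_density_has_density jr.
rewrite (mutual_info_joint_density jr) (KL_density hZ).
under eq_integral do rewrite -log2k.
set J := distribution P (pairf X Z).
have mlr : measurable_fun [set: M.-tuple R * M.-tuple R] (fun p => log2 (r p)).
  exact: measurable_log2.
have mlk : measurable_fun [set: M.-tuple R] (fun z => log2 (k z)) by exact: measurable_log2.
have mlk2 : measurable_fun [set: M.-tuple R * M.-tuple R] (fun p => log2 (k p.2)).
  exact: (measurableT_comp mlk measurable_snd).
have rk p : (log2 (r p) + log2 (k p.2) = log2 (channel_ratio p))%R.
  by rewrite /log2 ln_div ?posrE ?channel_ratio_gt0// mulrBl subrK.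
have [iq qE] := integral_log2_channel_ratio.
have mlq : measurable_fun [set: M.-tuple R * M.-tuple R] (fun p => log2 (channel_ratio p)).
  by apply: measurable_log2; exact: measurable_channel_ratio.
have iqJ : J.-integrable [set: M.-tuple R * M.-tuple R] (fun p => (log2 (channel_ratio p))%:E).
  apply/integrableP; split; first exact/measurable_EFinP.
  case/integrableP : iq => _; rewrite ge0_integral_distribution//.
  by apply: measurableT_comp => //; exact/measurable_EFinP.
have nr := negpart_log2_density Jr.
have nk : \int[J]_p (EFin \o (fun p => log2 (k p.2)))^\- p < +oo.
  have := negpart_log2_density hZ.
  under eq_integral do rewrite funenegE -log2k.
  under [X in _ -> X < _]eq_integral do rewrite funenegE.
  rewrite !ge0_integral_distribution//.
  - apply: measurable_maxe => //; apply: measurableT_comp => //; exact/measurable_EFinP.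
  - by move=> z; rewrite le_max lexx orbT.
  - apply: measurable_maxe => //; apply: measurableT_comp => //; exact/measurable_EFinP.
  - by move=> z; rewrite le_max lexx orbT.
(* So far only the sum of the two logarithms is known to be integrable; finiteness of both negative
   parts passes this on to each. *)
have ir : J.-integrable [set: M.-tuple R * M.-tuple R] (fun p => (log2 (r p))%:E).
  apply: (negpart_add_integrable mlr mlk2 nr nk).
  by under eq_fun do rewrite rk.
have ik : J.-integrable [set: M.-tuple R * M.-tuple R] (fun p => (log2 (k p.2))%:E).
  apply: (negpart_add_integrable mlk2 mlr nk nr).
  by under eq_fun do rewrite addrC rk.
have ikP : P.-integrable [set: T] (fun w => (log2 (k (Z w)))%:E).
  case/integrableP : ik => _ kfin; apply/integrableP; split.
    by apply/measurable_EFinP; apply: (measurableT_comp mlk).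
  move: kfin; rewrite ge0_integral_distribution//.
  by apply: measurableT_comp => //; exact/measurable_EFinP.
have -> : \int[distribution P Z]_z (log2 (k z))%:E = \int[J]_p (log2 (k p.2))%:E.
  rewrite !integral_distribution//; exact/measurable_EFinP.
split; first exact: integrable_fin_num.
rewrite -integralD// -qE.
under eq_integral do rewrite -EFinD rk.
by rewrite integral_distribution//; exact/measurable_EFinP.
Qed.

(** [a i] is the least-squares coefficient: input and output have covariance [a i * lam i], and the
    output has variance [lam i]. *)
Lemma channel_distortion :
  \int[P]_w (sqdist (X w) (vscale a (Z w)))%:E =
  (\sum_(i < M) ((1 - a i ^+ 2) ^+ 2 * lam i + (a i * b i) ^+ 2))%:E.
Proof.
transitivity (\int[P]_w (\sum_(i < M) ((1 * tnth (X w) i + (- a i) * tnth (Z w) i) ^+ 2)%:E)).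
  apply: eq_integral => w _; rewrite sumEFin; congr EFin; apply: eq_bigr => i _.
  by rewrite tnth_mktuple; congr (_ ^+ 2)%R; ring.
rewrite integral_sum//; last by move=> i; exact: integrable_square_combination.
rewrite -sumEFin; apply: eq_bigr => i _; rewrite channel_square; congr EFin; ring.
Qed.

(** A projection of [Z] is a sum of independent normal projections of [X] and [U]; by [ab] the
    variances add up to that under [mus]. *)
Lemma channel_output_gaussian : gaussian_vector P X ->
  forall A, measurable A -> distribution P Z A = mus A.
Proof.
move=> gX A mA; apply: gauss_vec_projection => // c F mF F0.
rewrite ge0_integral_distribution; last 2 first.
- exact: (measurableT_comp mF (measurable_dotv c)).
- by [].
pose ca := [tuple (tnth c i * a i)%R | i < M]; pose cb := [tuple (tnth c i * b i)%R | i < M].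
have dE w : dotv c (Z w) = (dotv ca (X w) + dotv cb (U w))%R.
  rewrite /dotv -big_split; apply: eq_bigr => i _.
  by rewrite ZE !tnth_mktuple /=; ring.
transitivity (\int[P]_w F (dotv ca (X w) + dotv cb (U w))%R).
  by apply: eq_integral => w _; rewrite /= dE.
have mD : measurable_fun [set: M.-tuple R * M.-tuple R] (fun p => (dotv ca p.1 + dotv cb p.2)%R).
  apply: measurable_funD.
    exact: (measurableT_comp (measurable_dotv _) measurable_fst).
  exact: (measurableT_comp (measurable_dotv _) measurable_snd).
rewrite (independent_integral indep (F := fun p => F (dotv ca p.1 + dotv cb p.2)%R)); last 2 first.
- exact: (measurableT_comp mF mD).
- by [].
pose s1 := Num.sqrt (\sum_(i < M) (tnth ca i * s i) ^+ 2)%R.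
pose s2 := Num.sqrt (\sum_(i < M) (tnth cb i * Num.sqrt 1) ^+ 2)%R.
have mFx x : measurable_fun [set: R] (fun y => F (x + y)%R).
  by apply: (measurableT_comp mF); exact: measurable_funD.
transitivity (\int[P]_w \int[std_gauss]_v F (dotv ca (X w) + s2 * v)%R).
  apply: eq_integral => w _ /=.
  by rewrite (gaussian_projection covU gU (fun=> ler01) cb (mFx _)).
have mG : measurable_fun [set: R] (fun x => \int[std_gauss]_v F (x + s2 * v)%R).
  apply: (@measurable_fun_fubini_tonelli_F _ _ _ _ R std_gauss
    (fun p : R * R => F (p.1 + s2 * p.2)%R)) => //.
  apply: (measurableT_comp mF); apply: measurable_funD => //.
  by apply: measurable_funM => //; exact: measurable_snd.
rewrite (gaussian_projection covX gX (fun i => ltW (lam0 i)) ca mG); last first.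
  by move=> x; exact: integral_ge0.
rewrite std_gauss_rotation//; apply: eq_integral => u _; congr (F (Num.sqrt _ * _)%R).
rewrite !sqr_sqrtr ?sumr_ge0// => [|i _|i _]; [|exact: sqr_ge0|exact: sqr_ge0].
rewrite -big_split; apply: eq_bigr => i _ /=; rewrite !tnth_mktuple sqrtr1 mulr1.
rewrite !exprMn sqr_sqrtr ?ltW// -[in RHS](ab i); ring.
Qed.

(** The coupling is [X] with the estimate [vscale a Z]. As [channel_ratio] depends on [z] only
    through [vscale a z], and [Z] has law [mus], it yields the density of this pair as well:
    rescaling the output loses no information. *)
Lemma channel_achieves : gaussian_vector P X ->
  exists pi : probability (M.-tuple R * M.-tuple R)%type R,
    [/\ (forall A, measurable A -> distribution pi fstf A = distribution P X A),
        \int[pi]_p (sqdist p.1 p.2)%:E =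
          (\sum_(i < M) ((1 - a i ^+ 2) ^+ 2 * lam i + (a i * b i) ^+ 2))%:E &
        mutual_info pi fstf sndf = channel_rate%:E].
Proof.
move=> gX.
have mY : measurable_fun [set: T] (fun w => vscale a (Z w)).
  exact: (measurableT_comp (measurable_vscale a) (measurable_funPT Z)).
pose Y : {mfun T >-> M.-tuple R} :=
  HB.pack_for {mfun T >-> M.-tuple R} (fun w => vscale a (Z w)) (isMeasurableFun.Build _ _ _ _ _ mY).
pose pi : probability _ R := distribution P (pairf X Y).
have msq : measurable_fun [set: M.-tuple R * M.-tuple R] (fun p => (sqdist p.1 p.2)%:E).
  apply/measurable_EFinP/measurable_sum => i; apply: measurable_funX; apply: measurable_funB.
    exact: (measurableT_comp (measurable_tnth i) measurable_fst).
  exact: (measurableT_comp (measurable_tnth i) measurable_snd).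
have sq0 (p : M.-tuple R * M.-tuple R) : 0 <= (sqdist p.1 p.2)%:E.
  by rewrite lee_fin sumr_ge0// => i _; exact: sqr_ge0.
exists pi; split => //.
  by rewrite ge0_integral_distribution// -channel_distortion.
pose q p := channel_ratio (p.1, vscale (fun i => (a i)^-1%R) p.2).
have mq : measurable_fun [set: M.-tuple R * M.-tuple R] q.
  apply: (measurableT_comp measurable_channel_ratio); apply: measurable_fun_pair => //.
  exact: (measurableT_comp (measurable_vscale _) measurable_snd).
(* For [a i = 0] the i-th factor of the ratio is constant, as then [b i = s i]. *)
have qE x z : q (x, vscale a z) = channel_ratio (x, z).
  rewrite /q /channel_ratio /vratio; apply: eq_bigr => i _ /=.
  rewrite !tnth_mktuple !add0r; have [ai|ai] := eqVneq (a i) 0%R; last by rewrite mulKf.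
  have bs : s i = b i.
    by rewrite /s -(ab i) ai expr0n/= mul0r add0r sqrtr_sqr ger0_norm// ltW.
  by rewrite /normal_ratio bs ai !mul0r !subr0 !subrr.
have jq : joint_density pi fstf sndf q.
  split; [exact: mq|by move=> p; exact/ltW/channel_ratio_gt0|move=> F mF F0].
  have mF' : measurable_fun [set: M.-tuple R * M.-tuple R] (fun p => F (p.1, vscale a p.2)).
    apply: (measurableT_comp mF); apply: measurable_fun_pair => //.
    exact: (measurableT_comp (measurable_vscale _) measurable_snd).
  have mFq : measurable_fun [set: M.-tuple R * M.-tuple R] (fun p => F p * (q p)%:E).
    by apply: emeasurable_funM => //; exact/measurable_EFinP.
  have Fq0 p : 0 <= F p * (q p)%:E.
    by rewrite mule_ge0// lee_fin ltW// channel_ratio_gt0.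
  transitivity (\int[P]_w F (X w, vscale a (Z w))).
    rewrite ge0_integral_distribution//.
    by apply: (measurableT_comp mF); apply: measurable_fun_pair.
  apply: (etrans (channel_integral mF' (fun p => F0 _))).
  have mx x : measurable_fun [set: M.-tuple R] (fun y => F (x, y) * (q (x, y))%:E).
    exact: (measurableT_comp mFq (pair1_measurable x)).
  have inner x : \int[distribution pi sndf]_y (F (x, y) * (q (x, y))%:E) =
      \int[mus]_z (F (x, vscale a z) * (channel_ratio (x, z))%:E).
    transitivity (\int[P]_w (F (x, vscale a (Z w)) * (q (x, vscale a (Z w)))%:E)).
      rewrite !ge0_integral_distribution//.
        exact: (measurableT_comp (mx x) measurable_snd).
      by move=> y; exact: Fq0.
    have mxa : measurable_fun [set: M.-tuple R]
        (fun z => F (x, vscale a z) * (q (x, vscale a z))%:E).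
      exact: (measurableT_comp (mx x) (measurable_vscale a)).
    transitivity (\int[distribution P Z]_z (F (x, vscale a z) * (q (x, vscale a z))%:E)).
      by rewrite ge0_integral_distribution.
    transitivity (\int[mus]_z (F (x, vscale a z) * (q (x, vscale a z))%:E)).
      by apply: eq_measure_integral => A mA _; exact: channel_output_gaussian.
    by apply: eq_integral => z _; rewrite qE.
  under [RHS]eq_integral do rewrite inner.
  apply: eq_measure_integral => A mA _; by [].
rewrite (mutual_info_joint_density jq).
have [iq <-] := integral_log2_channel_ratio.
have mlq : measurable_fun [set: M.-tuple R * M.-tuple R] (fun p => (log2 (q p))%:E).
  exact/measurable_EFinP/measurable_log2.
have iqY : P.-integrable [set: T] (fun w => (log2 (q (X w, vscale a (Z w))))%:E).
  by under eq_fun do rewrite qE.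
have iqpi : pi.-integrable setT (fun p => (log2 (q p))%:E).
  apply/integrableP; split => //; case/integrableP : iqY => _.
  by rewrite ge0_integral_distribution//; exact: measurableT_comp.
have pE : (fun p => (log2 (q p))%:E) \o pairf fstf sndf = (fun p => (log2 (q p))%:E).
  by apply/funext => -[].
rewrite integral_distribution ?pE//.
transitivity (\int[P]_w (log2 (q (X w, vscale a (Z w))))%:E).
  exact: (@integral_distribution _ _ _ _ _ P (pairf X Y) _ mlq iqY).
by apply: eq_integral => w _; rewrite /= qE.
Qed.
End channel.

(** * Sampling from a conditional law *)

Section conditional_law.
Context {dS dY dZ : measure_display} {S : measurableType dS} {Y : measurableType dY}
  {Z : measurableType dZ} {R : realType}.
Local Open Scope ereal_scope.

Definition const_kernel (rho : probability S R) : unit -> {measure set S -> \bar R} :=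
  fun=> rho.
HB.instance Definition _ rho := isKernel.Build _ _ unit S R (const_kernel rho)
  (fun U _ => measurable_cst _).
HB.instance Definition _ rho := Kernel_isProbability.Build _ _ unit S R
  (const_kernel rho) (fun=> probability_setT rho).

Definition kernel_prob (k : R.-pker Z ~> Y) (z : Z) : set Y -> \bar R := k z.
HB.instance Definition _ k z := isMeasure.Build _ _ _ (kernel_prob k z)
  (measure0 (k z)) (measure_ge0 (k z)) (@measure_semi_sigma_additive _ _ _ (k z)).
HB.instance Definition _ k z := @Measure_isProbability.Build _ _ R (kernel_prob k z)
  (prob_kernel z).

Definition pull_kernel (k : R.-pker Z ~> Y) (f : {mfun S >-> Z}) :
  S -> {measure set Y -> \bar R} := fun s => k (f s).
HB.instance Definition _ k f := isKernel.Build _ _ S Y R (pull_kernel k f)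
  (fun U mU => measurableT_comp (measurable_kernel k U mU) (measurable_funPT f)).
HB.instance Definition _ k f := Kernel_isProbability.Build _ _ S Y R
  (pull_kernel k f) (fun s => prob_kernel (f s)).

(** Composing [rho] with this kernel gives the joint law of [(s, y)] with [s] of law [rho] and [y]
    of law [k s]. The source [unit * S] is the one that [kcomp] after [const_kernel] calls for. *)
Definition graph_kernel (k : R.-pker S ~> Y) :
    unit * S -> {measure set (S * Y) -> \bar R} :=
  fun p => measure_function_pushforward__canonical__measure_function_Measure
    (k p.2) (pair1_measurable p.2).

Lemma measurable_graph_kernel k U : measurable U ->
  measurable_fun [set: unit * S] (graph_kernel k ^~ U).
Proof.
move=> mU; rewrite (_ : graph_kernel k ^~ U = (fun s => k s (xsection U s)) \o snd).
  apply: measurableT_comp => //.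
  by apply: measurable_fun_xsection_finite_kernel; rewrite inE.
by apply/funext => p; rewrite /= xsectionE.
Qed.
HB.instance Definition _ k := isKernel.Build _ _ (unit * S)%type (S * Y)%type R
  (graph_kernel k) (@measurable_graph_kernel k).
Lemma graph_kernelT k p : graph_kernel k p [set: S * Y] = 1.
Proof. exact: (prob_kernel (s := k) p.2). Qed.
HB.instance Definition _ k := Kernel_isProbability.Build _ _ (unit * S)%type (S * Y)%type R
  (graph_kernel k) (@graph_kernelT k).

(* It suffices to test the conditional law on a pi-system generating the sigma-algebra of [S]. *)
Lemma conditional_law_integral (m : probability (S * Y)%type R) (rho : probability S R)
    (k : R.-pker S ~> Y) (G : set (set S)) :
  measurable = <<s G >> -> setI_closed G -> G setT ->
  (forall (A : set S) (B : set Y), G A -> measurable B ->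
    m (A `*` B) = \int[rho]_(s in A) k s B) ->
  forall F : S * Y -> \bar R, measurable_fun [set: S * Y] F -> (forall p, 0 <= F p) ->
  \int[m]_p F p = \int[rho]_s \int[k s]_y F (s, y).
Proof.
move=> mG GI GT mE F mF F0.
pose M : {measure set (S * Y)%type -> \bar R} :=
  kcomp (const_kernel rho) (graph_kernel k) tt.
have ME A B : measurable A -> measurable B -> M (A `*` B) = \int[rho]_(s in A) k s B.
  move=> mA mB; rewrite [RHS]integral_mkcond; apply: eq_integral => s _; rewrite patchE /=.
  rewrite -[LHS]/(k s ((pair s) @^-1` (A `*` B))) -xsectionE.
  by case: ifPn => As; [rewrite in_xsectionX|rewrite notin_xsectionX ?measure0].
transitivity (\int[M]_p F p); last first.
  transitivity (\int[kcomp (const_kernel rho) (graph_kernel k) tt]_p F p); first by [].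
  rewrite integral_kcomp//; apply: eq_integral => s _.
  by rewrite (ge0_integral_pushforward (pair1_measurable s)).
(* Uniqueness of measures is used twice: here for fixed [B], to pass from [G] to all measurable [A],
   and below to pass from rectangles to the product sigma-algebra. *)
have rect A B : measurable A -> measurable B -> m (A `*` B) = M (A `*` B).
  move=> mA mB.
  have mTB : measurable ([set: S] `*` B) by exact: measurableX.
  pose push (mu : {measure set (S * Y)%type -> \bar R}) : {measure set S -> \bar R} :=
    measure_function_pushforward__canonical__measure_function_Measure
      (mrestr mu mTB) (@measurable_fst _ _ S Y).
  have pushE (mu : {measure set (S * Y)%type -> \bar R}) C : push mu C = mu (C `*` B).
    rewrite -[LHS]/(mu ((fst @^-1` C) `&` ([set: S] `*` B))); congr (mu _).
    by apply/seteqP; split => -[x y] /=; [case=> ? []|case].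
  rewrite -!pushE; apply: (measure_unique G (fun=> setT)) => //.
  - by rewrite bigcup_const.
  - move=> C GC; rewrite !pushE ME//; last by rewrite mG; exact: sub_sigma_algebra.
    exact: mE.
  - move=> _; rewrite pushE; apply: le_lt_trans (probability_le1 m (measurableX measurableT mB)) _.
    exact: ltry.
apply: eq_measure_integral => E mE' _.
apply: (measure_unique [set A `*` B | A in measurable & B in measurable] (fun=> setT)) => //.
- exact: measurable_prod_measurableType.
- move=> _ _ [A mA [B mB <-]] [A' mA' [B' mB' <-]].
  exists (A `&` A'); first exact: measurableI.
  by exists (B `&` B'); [exact: measurableI|rewrite setXI].
- by move=> _; exists setT => //; exists setT => //; rewrite setXTT.
- by rewrite bigcup_const.
- by move=> _ [A mA [B mB <-]]; exact: rect.
- move=> _; apply: le_lt_trans (probability_le1 m measurableT) _; exact: ltry.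
Qed.
End conditional_law.

Section conditional_copy.
Context {d d1 d2 : measure_display} {T : measurableType d} {T1 : measurableType d1}
  {T2 : measurableType d2} {R : realType}.
Variables (P : probability T R) (X Xh : {mfun T >-> T1}) (Z : {mfun T >-> T2}).
Hypothesis drawn : drawn_from_conditional P X Z Xh.
Local Open Scope ereal_scope.

(** For independent copies the left-hand side is twice the variance, and the second moment about any
    [c] is at least the variance. *)
Lemma variance_copy (nu : probability T1 R) (f : T1 -> R) (c : R) :
  measurable_fun [set: T1] f ->
  \int[nu]_x \int[nu]_y ((f x - f y) ^+ 2)%:E <= 2%:E * \int[nu]_x ((f x - c) ^+ 2)%:E.
Proof.
move=> mf; pose e x := (f x - c)%R.
have me : measurable_fun [set: T1] e by exact: measurable_funB.
have me2 : measurable_fun [set: T1] (fun x => (e x ^+ 2)%:E).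
  by apply/measurable_EFinP; exact: measurable_funX.
have [h|h] := leP +oo (\int[nu]_x ((e x) ^+ 2)%:E).
  move: h; rewrite leye_eq => /eqP ->.
  by rewrite gt0_muley ?lte_fin// leey.
have ie2 : nu.-integrable [set: T1] (fun x => (e x ^+ 2)%:E).
  apply/integrableP; split => //.
  by under eq_integral do rewrite gee0_abs ?lee_fin ?sqr_ge0//.
have ie := square_integrable_integrable me ie2.
have cst1 := integral_prob_cst nu.
have icst (r : R) : nu.-integrable [set: T1] (fun=> r%:E).
  exact: finite_measure_integrable_cst.
have /fineK m1E := integrable_fin_num measurableT ie.
have /fineK m2E := integrable_fin_num measurableT ie2.
set m1 := fine _ in m1E; set m2 := fine _ in m2E.
have inner x : \int[nu]_y ((f x - f y) ^+ 2)%:E = (e x ^+ 2)%:E + ((- 2 * m1)%:E * (e x)%:E + m2%:E).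
  transitivity (\int[nu]_y ((e x ^+ 2)%:E + ((- 2 * e x)%:E * (e y)%:E + (e y ^+ 2)%:E))).
    by apply: eq_integral => y _; rewrite -EFinM -!EFinD; congr EFin; rewrite /e; ring.
  rewrite integralD//; last by apply: integrableD => //; exact: integrableZl.
  rewrite integralD//; last exact: integrableZl.
  rewrite cst1 integralZl// -m1E -m2E -!EFinM; congr (_ + (EFin _ + _)); ring.
under eq_integral do rewrite inner.
rewrite integralD//; last by apply: integrableD => //; exact: integrableZl.
rewrite integralD//; last exact: integrableZl.
rewrite cst1 integralZl// -m1E -m2E -!EFinM -!EFinD lee_fin.
have := sqr_ge0 m1; rewrite expr2; lra.
Qed.

(** Given [Z = z], both [X] and [Xh] have law [k z] and they are independent, so [variance_copy]
    applies for each [z] with the estimate [c z] as centre. *)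
Lemma conditional_copy_le (f : T1 -> R) (c : T2 -> R) :
  measurable_fun [set: T1] f -> measurable_fun [set: T2] c ->
  \int[P]_w ((f (X w) - f (Xh w)) ^+ 2)%:E <= 2%:E * \int[P]_w ((f (X w) - c (Z w)) ^+ 2)%:E.
Proof.
move=> mf mc; have [k [kXZ kXhXZ]] := drawn.
have ZX F : measurable_fun [set: T2 * T1] F -> (forall p, 0 <= F p) ->
    \int[P]_w F (Z w, X w) = \int[P]_w \int[k (Z w)]_x F (Z w, x).
  move=> mF F0.
  have mT2 : @measurable _ T2 = <<s measurable >>.
    by apply/esym/sigma_algebra_id; exact: sigma_algebra_measurable.
  have := @conditional_law_integral _ _ _ _ _ (distribution P (pairf Z X)) (distribution P Z) k
    measurable mT2 (@measurableI _ T2) measurableT.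
  move=> /(_ _ F mF F0); rewrite ge0_integral_distribution//.
  rewrite ge0_integral_distribution//; last 2 first.
  - exact: measurable_fun_integral_finite_kernel.
  - by move=> z; exact: integral_ge0.
  apply=> A B mA mB; rewrite -[LHS]/(P (Z @^-1` A `&` X @^-1` B)) setIC kXZ//.
  have mkB := measurable_kernel k B mB.
  rewrite [in RHS]integral_mkcond ge0_integral_distribution//.
  - by rewrite [LHS]integral_mkcond; apply: eq_integral => w _; rewrite /= !patchE.
  - by apply/(measurable_restrictT _ mA).1; exact: measurable_funTS.
  - by move=> z; rewrite patchE; case: ifP.
pose S := (T1 * T2)%type.
have XZXh F : measurable_fun [set: S * T1] F -> (forall p, 0 <= F p) ->
    \int[P]_w F ((X w, Z w), Xh w) = \int[P]_w \int[k (Z w)]_y F ((X w, Z w), y).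
  move=> mF F0.
  have GI : setI_closed [set A `*` B | A in @measurable _ T1 & B in @measurable _ T2].
    move=> _ _ [A mA [B mB <-]] [A' mA' [B' mB' <-]].
    exists (A `&` A'); first exact: measurableI.
    by exists (B `&` B'); [exact: measurableI|rewrite setXI].
  have GT : [set A `*` B | A in @measurable _ T1 & B in @measurable _ T2] setT.
    by exists setT => //; exists setT => //; rewrite setXTT.
  (* The kernel on pairs [(X, Z)] looks at the second component only: this is the conditional
     independence of [Xh] and [X] given [Z]. *)
  pose k' : R.-pker S ~> T1 := pull_kernel k (@sndf _ _ T1 T2).
  have := @conditional_law_integral _ _ _ _ _ (distribution P (pairf (pairf X Z) Xh))
    (distribution P (pairf X Z)) k' _ (measurable_prod_measurableType T1 T2) GI GT.
  move=> /(_ _ F mF F0); rewrite ge0_integral_distribution//.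
  rewrite ge0_integral_distribution//; last 2 first.
  - exact: measurable_fun_integral_finite_kernel.
  - by move=> z; exact: integral_ge0.
  apply=> _ B [A mA [C mC <-]] mB.
  transitivity (P (Xh @^-1` B `&` X @^-1` A `&` Z @^-1` C)).
    rewrite -[LHS]/(P (X @^-1` A `&` Z @^-1` C `&` Xh @^-1` B)); congr (P _).
    by rewrite setIC setIA.
  rewrite kXhXZ//.
  have mkB : measurable_fun [set: S] (fun s => k' s B) by exact: (measurable_kernel k' B mB).
  rewrite [in RHS]integral_mkcond ge0_integral_distribution//.
  - by rewrite [LHS]integral_mkcond; apply: eq_integral => w _; rewrite /= !patchE.
  - have mAC : measurable (A `*` C) by exact: measurableX.
    have mD : measurable_fun (A `*` C) (fun s : S => k' s B).
      exact: (@measurable_funS _ _ S _ setT (A `*` C) _ measurableT (@subsetT _ _) mkB).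
    exact: (iffLR (measurable_restrictT _ mAC) mD).
  - by move=> z; rewrite patchE; case: ifP.
have mF1 : measurable_fun [set: S * T1] (fun p => ((f p.1.1 - f p.2) ^+ 2)%:E).
  apply/measurable_EFinP/measurable_funX/measurable_funB.
    exact: (measurableT_comp mf (measurableT_comp measurable_fst measurable_fst)).
  exact: (measurableT_comp mf measurable_snd).
rewrite (XZXh (fun p => ((f p.1.1 - f p.2) ^+ 2)%:E))//; last first.
  by move=> p; rewrite lee_fin sqr_ge0.
have mF2 : measurable_fun [set: T2 * T1] (fun p => ((f p.2 - c p.1) ^+ 2)%:E).
  apply/measurable_EFinP/measurable_funX/measurable_funB.
    exact: (measurableT_comp mf measurable_snd).
  exact: (measurableT_comp mc measurable_fst).
rewrite (ZX (fun p => ((f p.2 - c p.1) ^+ 2)%:E))//; last first.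
  by move=> p; rewrite lee_fin sqr_ge0.
have mF3 : measurable_fun [set: (T2 * T1) * T1] (fun p => ((f p.1.2 - f p.2) ^+ 2)%:E).
  apply/measurable_EFinP/measurable_funX/measurable_funB.
    exact: (measurableT_comp mf (measurableT_comp measurable_snd measurable_fst)).
  exact: (measurableT_comp mf measurable_snd).
have mG3 : measurable_fun [set: T2 * T1] (fun p => \int[k p.1]_y ((f p.2 - f y) ^+ 2)%:E).
  apply: (measurable_fun_integral_finite_kernel (fun p => ((f p.1.2 - f p.2) ^+ 2)%:E)
    (pull_kernel k (@fstf _ _ T2 T1))) => //.
  by move=> p; rewrite lee_fin sqr_ge0.
rewrite (ZX (fun p => \int[k p.1]_y ((f p.2 - f y) ^+ 2)%:E))//; last first.
  by move=> p; apply: integral_ge0 => y _; rewrite lee_fin sqr_ge0.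
have mI (H : T2 * T1 -> \bar R) : measurable_fun [set: T2 * T1] H -> (forall p, 0 <= H p) ->
    measurable_fun [set: T] (fun w => \int[k (Z w)]_x H (Z w, x)).
  move=> mH H0.
  exact: (measurableT_comp (measurable_fun_integral_finite_kernel H k H0 mH) (measurable_funPT Z)).
have sq0 (p : T2 * T1) : 0 <= ((f p.2 - c p.1) ^+ 2)%:E by rewrite lee_fin sqr_ge0.
have int0 (p : T2 * T1) : 0 <= \int[k p.1]_y ((f p.2 - f y) ^+ 2)%:E.
  by apply: integral_ge0 => y _; rewrite lee_fin sqr_ge0.
have mI2 := mI _ mF2 sq0; have mI3 := mI _ mG3 int0.
rewrite -ge0_integralZl//; last by move=> w _; apply: integral_ge0 => y _; exact: sq0.
apply: ge0_le_integral => //.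
- by move=> w _; apply: integral_ge0 => x _; exact: int0.
- exact: measurable_funeM.
- by move=> w _; exact: (@variance_copy (kernel_prob k (Z w)) f (c (Z w)) mf).
Qed.
End conditional_copy.

(** * Reverse water-filling *)

Section KL_facts.
Context {d : measure_display} {T : measurableType d} {R : realType}.
Local Open Scope ereal_scope.

Lemma has_density_eq (nu mu mu' : probability T R) f :
  (forall A, measurable A -> mu A = mu' A) -> has_density nu mu f -> has_density nu mu' f.
Proof.
move=> mumu' [mf f0 nuE]; split => // A mA; rewrite nuE//.
by apply: eq_measure_integral => B mB _; exact: mumu'.
Qed.

(** Laws are identified by their values on measurable sets, not as terms, so replacing one inside
    [KL] goes through a common density. *)
Lemma KL_eqr (nu mu mu' : probability T R) :
  (forall A, measurable A -> mu A = mu' A) -> KL nu mu = KL nu mu'.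
Proof.
move=> mumu'; have [numu|numu] := pselect (nu `<< mu).
  have [f nuf] := dominates_has_density numu.
  by rewrite (KL_density nuf) (KL_density (has_density_eq mumu' nuf)).
have numu' : ~ nu `<< mu'.
  move=> /dominates_has_density[f nuf]; apply: numu; apply: (@has_density_dominates _ _ _ nu mu f).
  by apply: has_density_eq nuf => A mA; rewrite mumu'.
by rewrite /KL; case: pselect => //=; case: pselect.
Qed.

Lemma KL_eql (nu nu' mu : probability T R) :
  (forall A, measurable A -> nu A = nu' A) -> KL nu mu = KL nu' mu.
Proof.
have dens (m m' : probability T R) f : (forall A, measurable A -> m A = m' A) ->
    has_density m mu f -> has_density m' mu f.
  by move=> mm' [mf f0 mE]; split => // A mA; rewrite -mm'// mE.
move=> nunu'; have [numu|numu] := pselect (nu `<< mu).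
  have [f nuf] := dominates_has_density numu.
  rewrite (KL_density nuf) (KL_density (dens _ _ _ nunu' nuf)).
  by apply: eq_measure_integral => B mB _; exact: nunu'.
have numu' : ~ nu' `<< mu.
  move=> /dominates_has_density[f nuf]; apply: numu; apply: (@has_density_dominates _ _ _ nu mu f).
  by apply: dens nuf => A mA; rewrite nunu'.
by rewrite /KL; case: pselect => //=; case: pselect.
Qed.

Lemma KL_eq0 (nu mu : probability T R) :
  (forall A, measurable A -> nu A = mu A) -> KL nu mu = 0.
Proof.
move=> numu; have h : has_density nu mu (cst 1%R).
  split => // A mA; rewrite (eq_integral (cst 1))//.
  by rewrite integral_cst// mul1e; exact: numu.
rewrite (KL_density h) (eq_integral (cst 0)) ?integral0// => x _.
by rewrite /log2 ln1 mul0r.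
Qed.

End KL_facts.

Section nonnegativity.
Local Open Scope ereal_scope.
(** The zero function is a valid test function when [mus] is the law of [X] itself, whose divergence
    from itself is 0. *)
Lemma mutual_info_ge0 (R : realType) d d1 d2 (T : measurableType d)
    (T1 : measurableType d1) (T2 : measurableType d2)
    (P : probability T R) (X : {mfun T >-> T1}) (Y : {mfun T >-> T2}) :
  0 <= mutual_info P X Y.
Proof.
pose z := @cst (T1 * T2)%type R 0%R.
have mz : measurable_fun [set: T1 * T2] z by exact: measurable_cst.
have z1 y : \int[distribution P X]_x (expR (z (x, y)))%:E <= 1.
  under eq_integral do rewrite expR0.
  by rewrite integral_cst// mul1e; apply: probability_le1.
have iz : P.-integrable [set: T] (fun w => (z (X w, Y w))%:E).
  exact: finite_measure_integrable_cst.
have := mutual_info_KL_ge mz z1 iz.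
have K0 : KL (distribution P X) (distribution P X) = 0 by exact: KL_eq0.
rewrite K0 adde0.
by apply: le_trans; rewrite (eq_integral (cst 0)) ?integral0// => x _; rewrite /z mul0r.
Qed.
End nonnegativity.

Section water_filling.
Context {R : realType} {M : nat}.
Variable lam : 'I_M -> R.
Hypothesis lam0 : forall i, 0 < lam i.

(* Distortion and rate of the reverse water-filling solution at level [th]. *)
Definition water_distortion (th : R) : R := \sum_(i < M) Num.min (lam i) th.
Definition water_rate (th : R) : R := (\sum_(i < M) ln (Num.max (lam i) th / th) / 2) / ln 2.

Lemma continuous_water_distortion : continuous water_distortion.
Proof.
suff H (r : seq 'I_M) : continuous (fun th => \sum_(i <- r) Num.min (lam i) th) by exact: H.
elim: r => [|i r IH] x.
  rewrite (_ : (fun th => _) = cst 0); first exact: cvg_cst.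
  by apply/funext => t; rewrite big_nil.
rewrite (_ : (fun th => _) = (fun th => Num.min (lam i) th + \sum_(j <- r) Num.min (lam j) th)); last first.
  by apply/funext => t; rewrite big_cons.
apply: cvgD; last exact: IH.
have E (t : R) : Num.min (lam i) t = (lam i + t - `|lam i - t|) / 2.
  by case: (leP (lam i) t) => h; [rewrite ler0_norm|rewrite gtr0_norm]; lra.
rewrite E (_ : Num.min (lam i) = (fun t => (lam i + t - `|lam i - t|) / 2)); last exact/funext.
apply: cvgM; last exact: cvg_cst.
apply: cvgB; first by apply: cvgD; [exact: cvg_cst|exact: cvg_id].
by apply: cvg_norm; apply: cvgB; [exact: cvg_cst|exact: cvg_id].
Qed.

(** Intermediate values between level 0, of distortion 0, and [th]; a positive [e] excludes the
    level 0. *)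
Lemma water_distortion_surj (th e : R) : 0 <= th -> 0 < e <= water_distortion th ->
  exists2 th', 0 < th' & water_distortion th' = e.
Proof.
move=> th0 /andP[e0 eth].
have w0 : water_distortion 0 = 0.
  by rewrite /water_distortion big1// => i _; rewrite min_r// ltW.
have [||c /itvP c0 cE] := @IVT R water_distortion 0 th e th0.
- exact/continuous_subspaceT/continuous_water_distortion.
- by rewrite w0 min_l ?max_r ?(ltW e0)//; exact: le_trans (ltW e0) eth.
exists c => //; rewrite lt_neqAle c0 andbT; apply/eqP => c00.
by move: e0; rewrite -cE -c00 w0 ltxx.
Qed.

Lemma water_rate_unbounded (i : 'I_M) (r : R) : exists2 th, 0 < th & r < water_rate th.
Proof.
(* At this level the i-th coordinate alone contributes [|r| + 1] bits. *)
pose th := lam i * expR (- (2 * ln 2 * (`|r| + 1))).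
have th0 : 0 < th by rewrite mulr_gt0// expR_gt0.
exists th => //; rewrite /water_rate ltr_pdivlMr ?ln2_gt0// (bigD1 i)//=.
have pos j : 0 <= ln (Num.max (lam j) th / th) / 2.
  by rewrite divr_ge0// ln_ge0// ler_pdivlMr// mul1r le_max lexx orbT.
have rest : 0 <= \sum_(j < M | j != i) ln (Num.max (lam j) th / th) / 2.
  by apply: sumr_ge0 => j _.
have l2 : 0 < ln 2 :> R by exact: ln2_gt0.
have main : ln 2 * (`|r| + 1) <= ln (Num.max (lam i) th / th) / 2.
  have thE : lam i / th = expR (2 * ln 2 * (`|r| + 1)).
    by rewrite /th invfM mulrA divff ?gt_eqF// mul1r -expRN opprK.
  apply: (@le_trans _ _ (ln (lam i / th) / 2)).
    rewrite thE expRK; lra.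
  rewrite ler_pM2r ?invr_gt0// ler_ln ?posrE ?divr_gt0//; last by rewrite lt_max lam0.
  by rewrite ler_pM2r ?invr_gt0// le_max lexx.
have := ler_norm r => rr.
have : r * ln 2 <= `|r| * ln 2 by rewrite ler_pM2r.
lra.
Qed.

Section noise_level.
Variable th : R.
Hypothesis th0 : 0 < th.
Let g := gamma2 th lam.
Let a i := Num.sqrt (1 - g i).
Let b i := Num.sqrt (g i) * Num.sqrt (lam i).

Let g_gt0 i : 0 < g i.
Proof. by rewrite /g /gamma2 lt_min ltr01 divr_gt0. Qed.

Let g_le1 i : g i <= 1.
Proof. by rewrite /g /gamma2 ge_min lexx. Qed.

Let gE i : g i * lam i = Num.min (lam i) th.
Proof.
rewrite /g /gamma2; case: (leP 1 (th / lam i)) => h.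
  by rewrite mul1r min_l// -[leLHS]mul1r -ler_pdivlMr.
rewrite divfK ?gt_eqF// min_r// ltW//.
by move: h; rewrite ltr_pdivrMr// mul1r.
Qed.

Let a2 i : a i ^+ 2 = 1 - g i. Proof. by rewrite sqr_sqrtr// subr_ge0. Qed.
Let b2 i : b i ^+ 2 = g i * lam i. Proof. by rewrite exprMn !sqr_sqrtr// ltW. Qed.

Lemma noise_gt0 i : 0 < b i.
Proof. by rewrite mulr_gt0 ?sqrtr_gt0. Qed.

Lemma noise_variance i : a i ^+ 2 * lam i + b i ^+ 2 = lam i.
Proof. by rewrite a2 b2; ring. Qed.

(** With [g = gamma2 th lam i], a coordinate contributes [g ^+ 2 * lam i + (1 - g) * g * lam i = g *
    lam i], the smaller of [lam i] and [th]. *)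
Lemma noise_distortion :
  \sum_(i < M) ((1 - a i ^+ 2) ^+ 2 * lam i + (a i * b i) ^+ 2) = water_distortion th.
Proof. by apply: eq_bigr => i _; rewrite exprMn a2 b2 -gE; ring. Qed.

(** The squared ratio of standard deviations is [lam i] over the smaller of [lam i] and [th], which
    equals the larger one over [th]. *)
Lemma noise_rate : channel_rate lam b = water_rate th.
Proof.
rewrite /channel_rate /water_rate; congr (_ / _); apply: eq_bigr => i _.
have q0 : 0 < Num.sqrt (lam i) / b i by rewrite divr_gt0 ?sqrtr_gt0 ?noise_gt0.
have -> : Num.max (lam i) th / th = (Num.sqrt (lam i) / b i) ^+ 2.
  rewrite expr_div_n b2 gE sqr_sqrtr ?ltW//.
  by case: (leP (lam i) th) => h //; rewrite !divff ?gt_eqF.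
by rewrite lnXn// -[X in _ = X / _]mulr_natr mulfK.
Qed.
End noise_level.

Section lower_bound.
Context {d : measure_display} {T : measurableType d}.
Variables (P : probability T R) (X Y : {mfun T >-> M.-tuple R})
  (mus : probability (M.-tuple R) R) (th : R).
Hypothesis th0 : 0 < th.
Hypothesis musE : forall A, measurable A -> mus A = gauss_vec (fun i => Num.sqrt (lam i)) A.
Hypothesis EX2 : forall i, (\int[P]_w ((tnth (X w) i) ^+ 2)%:E = (lam i)%:E)%E.
Hypothesis Esq : (\int[P]_w (sqdist (X w) (Y w))%:E <= (water_distortion th)%:E)%E.

Let m i := Num.max (lam i) th.
Let m0 i : 0 < m i. Proof. by rewrite lt_max lam0. Qed.
Let gi i (x y : R) := ln (m i / th) / 2 - (x - y) ^+ 2 / (2 * th) + x ^+ 2 / (2 * m i).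
Let gs (p : M.-tuple R * M.-tuple R) := \sum_(i < M) gi i (tnth p.1 i) (tnth p.2 i).

Let measurable_gi d' (T' : measurableType d') i (x y : T' -> R) :
  measurable_fun setT x -> measurable_fun setT y ->
  measurable_fun setT (fun w => gi i (x w) (y w)).
Proof.
move=> mx my; apply: measurable_funD; last first.
  by apply: measurable_funM => //; exact: measurable_funX.
apply: measurable_funB => //; apply: measurable_funM => //.
by apply: measurable_funX; exact: measurable_funB.
Qed.

Let measurable_gs : measurable_fun setT gs.
Proof.
apply: measurable_sum => i; apply: measurable_gi.
  exact: (measurableT_comp (measurable_tnth i) measurable_fst).
exact: (measurableT_comp (measurable_tnth i) measurable_snd).
Qed.

Let gs_le1 y : (\int[mus]_x (expR (gs (x, y)))%:E <= 1)%E.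
Proof.
have me : measurable_fun [set: M.-tuple R] (fun x => (expR (gs (x, y)))%:E).
  apply/measurable_EFinP/(measurableT_comp (@measurable_expR R)).
  exact: (measurableT_comp measurable_gs (pair2_measurable y)).
rewrite (_ : (\int[mus]_x _ = \int[gauss_vec (fun i => Num.sqrt (lam i))]_x (expR (gs (x, y)))%:E)%E); last first.
  by apply: eq_measure_integral => A mA _; exact: musE.
rewrite ge0_integral_gauss_vec//.
under eq_integral => u _.
  rewrite /gs expR_sum.
  under eq_bigr do rewrite tnth_mktuple add0r.
  over.
rewrite /=.
apply: (std_gauss_tuple_prod_le1 (f := fun i u => expR (gi i (Num.sqrt (lam i) * u) (tnth y i)))).
- move=> i; apply: (measurableT_comp (@measurable_expR R)); apply: measurable_gi => //.
- by move=> i u; exact: expR_ge0.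
- move=> i; have s0 : 0 < Num.sqrt (lam i) by rewrite sqrtr_gt0.
  have H := normal_certificate (tnth y i) s0 th0.
  cbv zeta in H; rewrite sqr_sqrtr in H; last exact: ltW.
  exact: H.
Qed.

(** The mean of [gs] exceeds the sum of the logarithms by the allowed distortion minus the actual
    one, divided by [2 * th], which [Esq] makes non-negative. *)
Lemma rate_lower_bound :
  ((water_rate th)%:E <= mutual_info P X Y + KL (distribution P X) mus)%E.
Proof.
have mX i : measurable_fun setT (fun w => tnth (X w) i) by exact: measurable_coord.
have mY i : measurable_fun setT (fun w => tnth (Y w) i) by exact: measurable_coord.
have msq i : measurable_fun setT (fun w => ((tnth (X w) i - tnth (Y w) i) ^+ 2)%:E).
  by apply/measurable_EFinP/measurable_funX/measurable_funB.
have iX i : P.-integrable setT (fun w => ((tnth (X w) i) ^+ 2)%:E).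
  apply/integrableP; split; first by apply/measurable_EFinP; exact: measurable_funX.
  under eq_integral do rewrite gee0_abs ?lee_fin ?sqr_ge0//.
  by rewrite EX2 ltry.
have sqE : (\int[P]_w (sqdist (X w) (Y w))%:E =
    \sum_(i < M) \int[P]_w ((tnth (X w) i - tnth (Y w) i) ^+ 2)%:E)%E.
  under eq_integral do rewrite /sqdist -sumEFin.
  by rewrite ge0_integral_sum// => i w _; rewrite lee_fin sqr_ge0.
have sq0 i : (0 <= \int[P]_w ((tnth (X w) i - tnth (Y w) i) ^+ 2)%:E)%E.
  by apply: integral_ge0 => w _; rewrite lee_fin sqr_ge0.
have iXY i : P.-integrable setT (fun w => ((tnth (X w) i - tnth (Y w) i) ^+ 2)%:E).
  apply/integrableP; split => //.
  under eq_integral do rewrite gee0_abs ?lee_fin ?sqr_ge0//.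
  apply: le_lt_trans (ltry (water_distortion th)); apply: le_trans Esq.
  by rewrite sqE (bigD1 i)//= leeDl// sume_ge0.
pose q i := fine (\int[P]_w ((tnth (X w) i - tnth (Y w) i) ^+ 2)%:E)%E.
have qE i : (\int[P]_w ((tnth (X w) i - tnth (Y w) i) ^+ 2)%:E = (q i)%:E)%E.
  by rewrite fineK//; exact: integrable_fin_num.
have qle : \sum_(i < M) q i <= water_distortion th.
  by rewrite -lee_fin -sumEFin; under eq_bigr do rewrite -qE; rewrite -sqE.
pose tm i w : \bar R := ((ln (m i / th) / 2)%:E + ((- (2 * th)^-1)%:E *
  ((tnth (X w) i - tnth (Y w) i) ^+ 2)%:E + ((2 * m i)^-1)%:E * ((tnth (X w) i) ^+ 2)%:E))%E.
have gsE w : (gs (X w, Y w))%:E = (\sum_(i < M) tm i w)%E.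
  rewrite /gs -sumEFin; apply: eq_bigr => i _.
  by rewrite /tm /gi -!EFinM -!EFinD; congr EFin => /=; ring.
have icst (r : R) : P.-integrable setT (fun=> r%:E) by exact: finite_measure_integrable_cst.
have itm i : P.-integrable setT (tm i).
  by apply: integrableD => //; apply: integrableD => //; apply: integrableZl.
have igs : P.-integrable setT (fun w => (gs (X w, Y w))%:E).
  by under eq_fun do rewrite gsE; apply: integrable_sum => // i _; exact: itm.
have cst1 := integral_prob_cst P.
have Egs : (\int[P]_w (gs (X w, Y w))%:E = (\sum_(i < M) (ln (m i / th) / 2
    + (- (2 * th)^-1 * q i + (2 * m i)^-1 * lam i)))%:E)%E.
  under eq_integral do rewrite gsE.
  rewrite integral_sum// -sumEFin; apply: eq_bigr => i _.
  rewrite integralD//; last by apply: integrableD => //; exact: integrableZl.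
  rewrite integralD//; [|exact: integrableZl|exact: integrableZl].
  by rewrite cst1 !integralZl// qE EX2.
apply: le_trans (mutual_info_KL_ge measurable_gs gs_le1 igs).
under eq_integral do rewrite EFinM.
rewrite integralZr// Egs -EFinM lee_fin /water_rate ler_pM2r ?invr_gt0 ?ln2_gt0//.
rewrite big_split/= lerDl big_split/= -!mulr_sumr -/(water_distortion th).
have lm i : (2 * m i)^-1 * lam i = (2 * th)^-1 * Num.min (lam i) th.
  rewrite /m; case: (leP (lam i) th) => h //.
  by rewrite !invfM -!mulrA !mulVf ?gt_eqF.
under eq_bigr do rewrite lm.
rewrite -mulr_sumr -/(water_distortion th) mulNr addrC subr_ge0.
by rewrite ler_pM2l ?invr_gt0 ?mulr_gt0.
Qed.
End lower_bound.
End water_filling.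

Section coupling.
Context {d : measure_display} {T : measurableType d} {R : realType} {M : nat}.
Variables (P : probability T R) (lam : 'I_M -> R).
Local Open Scope ereal_scope.

Lemma coupling_second_moment (X : {mfun T >-> M.-tuple R})
    (pi : probability (M.-tuple R * M.-tuple R)%type R) i :
  centered_with_diag_cov P X lam ->
  (forall A, measurable A -> distribution pi fstf A = distribution P X A) ->
  \int[pi]_p ((tnth (fstf p) i) ^+ 2)%:E = (lam i)%:E.
Proof.
move=> covX piE.
have mF : measurable_fun [set: M.-tuple R] (fun x => ((tnth x i) ^+ 2)%:E : \bar R).
  by apply/measurable_EFinP; apply: measurable_funX; exact: measurable_tnth.
have F0 (x : M.-tuple R) : 0 <= ((tnth x i) ^+ 2)%:E by rewrite lee_fin sqr_ge0.
transitivity (\int[distribution pi fstf]_x ((tnth x i) ^+ 2)%:E).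
  by rewrite ge0_integral_distribution.
transitivity (\int[distribution P X]_x ((tnth x i) ^+ 2)%:E).
  by apply: eq_measure_integral => A mA _; exact: piE.
rewrite ge0_integral_distribution//.
by have := centered_cov covX i i; rewrite eqxx => <-; apply: eq_integral => w _.
Qed.

(** [conditional_copy_le] is used in each coordinate with a linear estimate, whose error
    [channel_distortion] evaluates. *)
Lemma sampled_distortion_le (X Xh Z : {mfun T >-> M.-tuple R}) (a : 'I_M -> R) :
  drawn_from_conditional P X Z Xh ->
  \int[P]_w (sqdist (X w) (Xh w))%:E <= 2%:E * \int[P]_w (sqdist (X w) (vscale a (Z w)))%:E.
Proof.
move=> drawn.
have sumE (Y : T -> M.-tuple R) : (forall i, measurable_fun [set: T] (fun w => tnth (Y w) i)) ->
    \int[P]_w (sqdist (X w) (Y w))%:E =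
    \sum_(i < M) \int[P]_w ((tnth (X w) i - tnth (Y w) i) ^+ 2)%:E.
  move=> mY; under eq_integral do rewrite /sqdist -sumEFin.
  rewrite ge0_integral_sum//.
    move=> i; apply/measurable_EFinP; apply: measurable_funX; apply: measurable_funB => //.
    exact: measurable_coord.
  by move=> i w _; rewrite lee_fin sqr_ge0.
rewrite !sumE; last 2 first.
- move=> i; exact: (measurableT_comp (measurable_tnth i)
    (measurableT_comp (measurable_vscale a) (measurable_funPT Z))).
- move=> i; exact: measurable_coord.
rewrite ge0_sume_distrr; last first.
  by move=> i _; apply: integral_ge0 => w _; rewrite lee_fin sqr_ge0.
apply: lee_sum => i _.
have ma : measurable_fun [set: M.-tuple R] (fun z => a i * tnth z i)%R.
  by apply: measurable_funM => //; exact: measurable_tnth.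
apply: le_trans (conditional_copy_le drawn (measurable_tnth i) ma) _.
rewrite le_eqVlt; apply/orP; left; apply/eqP; congr (_ * _).
by apply: eq_integral => w _; rewrite tnth_mktuple add0r.
Qed.
End coupling.

(** * Comparison with the rate-distortion functions, including zero distortion *)

Unset Implicit Arguments.
Theorem theorem1 (R : realType) (M : nat)
    (d : measure_display) (Omega : measurableType d) (P : probability Omega R)
    (X U Z Xh : {mfun Omega >-> M.-tuple R})
    (d' : measure_display) (Omega' : measurableType d')
    (P' : probability Omega' R)
    (Xs Us Zs : {mfun Omega' >-> M.-tuple R})
    (lam : 'I_M -> R) (theta : R) :
  (forall i, 0 < lam i) -> 0 < theta ->
  (* X: finite differential entropy, zero mean, covariance diag(lam) *)
  finite_diff_entropy P X ->
  centered_with_diag_cov P X lam ->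
  (* U ~ N(0, I), independent of X *)
  gaussian_vector P U -> centered_with_diag_cov P U (fun=> 1) ->
  independent P X U ->
  (* Z_i = sqrt(1 - gamma_i^2) X_i + gamma_i sqrt(lam_i) U_i *)
  noisy_observation theta lam X U Z ->
  (* Xh is drawn from P(X | Z) *)
  drawn_from_conditional P X Z Xh ->
  (* X* Gaussian with the same mean and covariance as X *)
  gaussian_vector P' Xs -> centered_with_diag_cov P' Xs lam ->
  (* Z* defined as Z with X* in place of X, noise U* ~ N(0,I) indep. of X* *)
  gaussian_vector P' Us -> centered_with_diag_cov P' Us (fun=> 1) ->
  independent P' Xs Us ->
  noisy_observation theta lam Xs Us Zs ->
  let D := (\int[P]_w (sqdist (X w) (Xh w))%:E)%E in
  (mutual_info P X Z
     <= rate_distortion (distribution P' Xs) (D * (2^-1)%:E)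
        - KL (distribution P Z) (distribution P' Zs)
     <= rate_distortion (distribution P X) (D * (2^-1)%:E)
        + KL (distribution P X) (distribution P' Xs)
        - KL (distribution P Z) (distribution P' Zs))%E.
Proof.
move=> lam0 theta0 _ covX gU covU indep ZE drawn gXs covXs gUs covUs indeps ZsE.
cbv zeta; set D := (\int[P]_w (sqdist (X w) (Xh w))%:E)%E.
have b0 := noise_gt0 lam0 theta0; have ab := noise_variance lam0 theta0.
have XsE := gaussian_gauss_vec covXs gXs (fun i => ltW (lam0 i)).
have ZsG := channel_output_gaussian lam0 ab covXs gUs covUs indeps ZsE gXs.
have [Kfin IK] := channel_information lam0 b0 ab covX gU covU indep ZE.
rewrite (KL_eqr (distribution P Z) ZsG) (noise_rate lam0 theta0) in IK *.
set K := KL (distribution P Z) _ in Kfin IK *.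
(* Resampling bounds [D] by twice the distortion at [theta]; so [D] is finite and its half is a real
   number within reach of the levels up to [theta]. *)
have [e e0 De] : exists2 e, 0 <= e <= water_distortion lam theta & (D * (2^-1)%:E = e%:E)%E.
  have Dle : (D <= (2 * water_distortion lam theta)%:E)%E.
    pose a i := Num.sqrt (1 - gamma2 theta lam i).
    apply: le_trans (sampled_distortion_le a drawn) _.
    rewrite (channel_distortion covX covU indep ZE).
    by rewrite (noise_distortion lam0 theta0) -EFinM.
  have D0 : (0 <= D)%E.
    by apply: integral_ge0 => w _; rewrite lee_fin sumr_ge0// => i _; exact: sqr_ge0.
  have Dfin : D \is a fin_num.
    by rewrite ge0_fin_numE//; apply: le_lt_trans Dle _; exact: ltry.
  exists (fine D / 2).
    rewrite divr_ge0 ?fine_ge0//= ler_pdivrMr// mulrC.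
    by rewrite -lee_fin fineK.
  by rewrite EFinM fineK.
rewrite De; have /andP[e_ge0 e_le] := e0.
(* The source [Y] is left open: [Xs] makes the divergence vanish for the first inequality, [X] keeps
   it for the second. *)
have lower_rate (th : R) (pi : probability (M.-tuple R * M.-tuple R)%type R)
    (d0 : measure_display) (T0 : measurableType d0) (P0 : probability T0 R)
    (Y : {mfun T0 >-> M.-tuple R}) : 0 < th -> centered_with_diag_cov P0 Y lam ->
    (forall A, measurable A -> distribution pi fstf A = distribution P0 Y A) ->
    (\int[pi]_p (sqdist p.1 p.2)%:E <= (water_distortion lam th)%:E)%E ->
    ((water_rate lam th)%:E <= mutual_info pi fstf sndf +
      KL (distribution P0 Y) (distribution P' Xs))%E.
  move=> th0 covY piE Epi.
  rewrite -(KL_eql (distribution P' Xs) piE).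
  apply: (rate_lower_bound lam0 th0 XsE (fun i => coupling_second_moment i covY piE)).
  by rewrite (eq_integral (fun p => (sqdist p.1 p.2)%:E)) => // p _.
apply/andP; split.
  (* Moving the finite [K] to the left turns the claim into a bound of the rate at [theta] by every
     admissible coupling; these meet the distortion at [theta] because [e] is at most that. *)
  rewrite leeBrDr// IK; apply: le_ereal_inf_tmp => _ [pi [piE Epi] <-].
  have := lower_rate theta pi _ _ P' Xs theta0 covXs piE.
  rewrite (KL_eq0 (mu := distribution P' Xs))// adde0; apply.
  by apply: le_trans Epi _; rewrite lee_fin.
apply: leeB => //.
set kappa := KL (distribution P X) _.
have kappa_gtNy : (-oo < kappa)%E by exact: KL_gtNy.
have rate_ge0 : (0 <= rate_distortion (distribution P X) e%:E)%E.
  by apply: le_ereal_inf_tmp => _ [pi _ <-]; exact: mutual_info_ge0.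
(* With [kappa] infinite the right-hand side is [+oo], since the rate-distortion function is
   non-negative; otherwise [kappa] may be moved across the inequality. *)
have [kfin|kinf] := boolP (kappa \is a fin_num); last first.
  have -> : kappa = +oo%E by move: kinf kappa_gtNy; case: kappa.
  by rewrite addey ?leey// gt_eqF// (lt_le_trans _ rate_ge0).
rewrite -leeBlDr//; apply: le_ereal_inf_tmp => _ [pi [piE Epi] <-]; rewrite leeBlDr//.
have lower th th0 := lower_rate th pi _ _ P X th0 covX piE.
(* At a level of distortion exactly [e], the Gaussian channel for [Xs] attains the rate that bounds
   every coupling of [X] from below. *)
have [[th th0 the]|noth] := pselect (exists2 th, 0 < th & water_distortion lam th = e).
  apply: le_trans (lower th th0 _); last by rewrite the.
  have b0' := noise_gt0 lam0 th0; have ab' := noise_variance lam0 th0.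
  pose a' i := Num.sqrt (1 - gamma2 th lam i).
  pose b' i := Num.sqrt (gamma2 th lam i) * Num.sqrt (lam i).
  pose z' w := vaff (fun i => a' i * tnth (Xs w) i) b' (Us w).
  have mz' : measurable_fun [set: Omega'] z'.
    apply: measurable_vaff => [i|]; last exact: measurable_funPT.
    by apply: measurable_funM => //; exact: measurable_coord.
  pose Z' : {mfun Omega' >-> M.-tuple R} :=
    HB.pack_for {mfun Omega' >-> M.-tuple R} z' (isMeasurableFun.Build _ _ _ _ z' mz').
  have Z'E w i : tnth (Z' w) i = a' i * tnth (Xs w) i + b' i * tnth (Us w) i.
    by rewrite tnth_mktuple.
  have [rho [rhoE Erho Irho]] :=
    channel_achieves lam0 b0' ab' covXs gUs covUs indeps Z'E gXs.
  apply: ge_ereal_inf; exists (mutual_info rho fstf sndf); last by rewrite Irho noise_rate.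
  by exists rho => //; split => //; rewrite Erho noise_distortion// the.
have e_eq0 : e = 0.
  apply/eqP; rewrite eq_le e_ge0 andbT leNgt; apply/negP => ep; apply: noth.
  by apply: (water_distortion_surj lam0 (ltW theta0)); rewrite ep.
(* In dimension 0 every level has distortion 0, so a level would exist after all. *)
have [i|M0] := pselect (exists i : 'I_M, True); last first.
  exfalso; apply: noth; exists 1 => //; rewrite e_eq0 /water_distortion big1// => i _.
  by exfalso; apply: M0; exists i.
have {i} [i _] := i.
(* A coupling with zero distortion meets the requirement of every level, and the rates grow without
   bound as the level decreases; so the sum is infinite. *)
have bound th : 0 < th -> ((water_rate lam th)%:E <= mutual_info pi fstf sndf + kappa)%E.
  move=> th0; apply: lower => //; apply: le_trans Epi _.
  by rewrite lee_fin e_eq0 sumr_ge0// => j _; rewrite le_min !ltW.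
suff -> : (mutual_info pi fstf sndf + kappa = +oo)%E by exact: leey.
case: (mutual_info pi fstf sndf + kappa)%E bound => [r| //|] bound.
  have [th th0 rth] := water_rate_unbounded lam0 i r.
  by have := bound th th0; rewrite lee_fin leNgt rth.
by have := bound 1 ltr01.
Qed.
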